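(* Let $X=\iota^{F'}_{F,b}(S^{r'}_{F',\mathcal K'})\subset S^r_{F,\mathcal K}$ be a Drinfeld modular subvariety, let $\mathfrak p$ be a good prime for $X$ (with decomposition $\mathcal K=\mathcal K_{\mathfrak p}\times\mathcal K^{(\mathfrak p)}$ as in the definition), and let $\mathfrak p'$ be a prime of $F'$ above $\mathfrak p$ with $[F'_{\mathfrak p'}:F_{\mathfrak p}]=1$. Then there is $g'=(1,\dots,1,g'_{\mathfrak p'},1,\dots,1)\in\mathrm{GL}_{r'}(\mathbb A^f_{F'})$ with $g'_{\mathfrak p'}\in\mathrm{GL}_{r'}(F'_{\mathfrak p'})$ such that for $g:=b^{-1}\circ g'\circ b\in\mathrm{GL}_r(\mathbb A_F^f)$: (i) $X\subset T_gX$; (ii) $[\mathcal K:\mathcal K\cap g^{-1}\mathcal Kg]=|k(\mathfrak p)|^{r-1}$; (iii) for all $k_1,k_2\in\mathcal K_{\mathfrak p}$, the cyclic subgroup of $\mathrm{PGL}_r(F_{\mathfrak p})$ generated by the image of $k_1g_{\mathfrak p}k_2$ is unbounded, where $g_{\mathfrak p}$ is the $\mathfrak p$-component of $g$.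
   Context: Let $F$ be a global function field with field of constants $\mathbb{F}_q$, $\infty$ a fixed place, $A$ the ring of elements regular outside $\infty$; for a prime (place $\mathfrak p\ne\infty$) let $F_{\mathfrak p},A_{\mathfrak p},k(\mathfrak p)$ be completion, valuation ring, residue field. $\mathbb{A}_F^f$ = finite adeles (outside $\infty$), $\mathbb A_F^{f,\mathfrak p}$ = adeles outside $\mathfrak p,\infty$, $\mathbb C_\infty$ the completion of an algebraic closure of $F_\infty$. For a finite extension $F'$ with integral closure $A'$ of $A$, $F'_{\mathfrak p}=F'\otimes_FF_{\mathfrak p}=\prod_{\mathfrak p'|\mathfrak p}F'_{\mathfrak p'}$, $A'_{\mathfrak p}=A'\otimes_AA_{\mathfrak p}$. $\Omega_F^r=\mathbb P^{r-1}(\mathbb C_\infty)\setminus\{F_\infty\text{-rational hyperplanes}\}$, points $\bar\omega$ = injective $F_\infty$-linear maps $\omega:F_\infty^r\to\mathbb C_\infty$ mod $\mathbb C_\infty^*$, $\mathrm{GL}_r(F)$ acting by $T\cdot\bar\omega=\overline{\omega\circ T^{-1}}$. For compact open $\mathcal K\subset\mathrm{GL}_r(\mathbb A_F^f)$ the Drinfeld modular variety $S^r_{F,\mathcal K}$ is the normal affine variety over $F$ of dimension $r-1$ with $S^r_{F,\mathcal K}(\mathbb C_\infty)=\mathrm{GL}_r(F)\backslash(\Omega^r_F\times\mathrm{GL}_r(\mathbb A_F^f)/\mathcal K)$. For $g\in\mathrm{GL}_r(\mathbb A^f_F)$ and compact open $\mathcal K''\subset g^{-1}\mathcal Kg$,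 $\pi_g:S^r_{F,\mathcal K''}\to S^r_{F,\mathcal K}$ is the finite morphism over $F$ given by $[(\bar\omega,h)]\mapsto[(\bar\omega,hg^{-1})]$; the Hecke correspondence is $T_g(Z)=\pi_g(\pi_1^{-1}(Z))$ for subvarieties $Z$, using $\pi_1,\pi_g:S^r_{F,\mathcal K\cap g^{-1}\mathcal Kg}\to S^r_{F,\mathcal K}$. Inclusions: for a finite extension $F'\subset\mathbb C_\infty$ of $F$ of degree $r/r'$ with one place above $\infty$ and an $\mathbb A_F^f$-linear isomorphism $b:(\mathbb A_F^f)^r\to(\mathbb A_{F'}^f)^{r'}$ (with local components $b_{\mathfrak p}:F_{\mathfrak p}^r\to F'^{r'}_{\mathfrak p}$), put $\mathcal K'=b\mathcal Kb^{-1}\cap\mathrm{GL}_{r'}(\mathbb A^f_{F'})$; $\iota^{F'}_{F,b}:S^{r'}_{F',\mathcal K'}\to S^r_{F,\mathcal K}$, $[(\bar\omega',h')]\mapsto[(\overline{\omega'\circ\phi},\phi^{-1}\circ h'\circ b)]$ ($\phi:F^r\to F'^{r'}$ any $F$-linear isomorphism) is a finite morphism over $F'$; its image is a Drinfeld modular subvariety. Good prime: $\mathfrak p$ is good for $X=\iota^{F'}_{F,b}(S^{r'}_{F',\mathcal K'})$ if there is a free $A_{\mathfrak p}$-submodule $\Lambda_{\mathfrak p}\subset F^r_{\mathfrak p}$ of rank $r$ with (i) $\mathcal K=\mathcal K_{\mathfrak p}\times\mathcal K^{(\mathfrak p)}$, $\mathcal K^{(\mathfrak p)}\subset\mathrm{GL}_r(\mathbb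 A_F^{f,\mathfrak p})$, $\mathcal K_{\mathfrak p}$ the kernel of $\mathrm{Stab}_{\mathrm{GL}_r(F_{\mathfrak p})}(\Lambda_{\mathfrak p})\to\mathrm{Aut}_{k(\mathfrak p)}(\Lambda_{\mathfrak p}/\mathfrak p\Lambda_{\mathfrak p})$; (ii) some prime of $F'$ above $\mathfrak p$ has local degree $1$ over $F_{\mathfrak p}$; (iii) $b_{\mathfrak p}(\Lambda_{\mathfrak p})$ is an $A'_{\mathfrak p}$-submodule of $F'^{r'}_{\mathfrak p}$.
   Formalization: Part (iii) is asserted only for r ≥ 2: when r = 1 the group PGL_1(F_p) is trivial, so its cyclic subgroups are bounded and (iii) as stated fails; parts (i) and (ii) are kept for all r ≥ 1. *)

(* Defs.v *)
From HB Require Import structures.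
From mathcomp Require Import all_boot all_order all_algebra all_field.
From mathcomp Require Import finmap all_classical topology.

Set Implicit Arguments.
Unset Strict Implicit.
Unset Printing Implicit Defensive.

Import Order.TTheory GRing.Theory Num.Theory.
Local Open Scope ring_scope.
Local Open Scope classical_set_scope.
Local Open Scope quotient_scope.

Section Valuation.
Context {G : realDomainType} {K : fieldType}.
Implicit Type v : K -> G.

(* Valuations take finite values only: the value +oo at 0 is replaced by the
   junk value 0, and [val_ge v n x] is the honest "v(x) >= n". *)
Definition val_ge v (n : G) (x : K) : Prop := x = 0 \/ n <= v x.

Definition valuation v : Prop :=
  [/\ v 0 = 0,
      forall x y, x != 0 -> y != 0 -> v (x * y) = v x + v y
    & forall n x y, val_ge v n x -> val_ge v n y -> val_ge v n (x + y)].

(* The value groups used below are subgroups of Q, so sequences suffice. *)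
Definition val_complete v : Prop :=
  forall u : nat -> K,
    (forall n, exists N, forall i j, (N <= i)%N -> (N <= j)%N ->
       val_ge v n (u i - u j)) ->
    exists l, forall n, exists N, forall i, (N <= i)%N -> val_ge v n (u i - l).

End Valuation.

Record completion (G : realDomainType) (K : fieldType) (v : K -> G) :=
  Completion {
    csort :> fieldType;
    cval : csort -> G;
    cemb : {rmorphism K -> csort};
    cvalP : valuation cval;
    cval_emb : forall x, cval (cemb x) = v x;
    cdense : forall x n, exists a, val_ge cval n (x - cemb a);
    ccomplete : val_complete cval }.

(* The continuous extension to the completion of [j : K -> L]: the graph of
   the extension is the closure of the graph of [j]. *)
Definition cont_ext (G H : realDomainType) (K L : fieldType) (v : K -> G)
    (Kh : completion v) (w : L -> H) (j : K -> L) (x : Kh) : L :=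
  xget 0 [set y | forall n m, exists a,
    val_ge (@cval _ _ _ Kh) n (x - cemb Kh a) /\ val_ge w m (y - j a)].

(* A place of a function field with finite field of constants is a normalized
   discrete valuation (constants are roots of unity or 0, so every valuation
   is trivial on them). *)
Record place (F : fieldType) := Place {
  place_val :> F -> int;
  place_valP : valuation place_val;
  place_normalized : exists x, place_val x = 1 }.

HB.instance Definition _ (F : fieldType) := gen_eqMixin (place F).
HB.instance Definition _ (F : fieldType) := gen_choiceMixin (place F).

Definition completions (F : fieldType) := forall v : place F, completion v.

Definition lies_above (F : fieldType) (F' : fieldExtType F)
    (w : place F') (v : place F) : Prop :=
  exists e : nat, (0 < e)%N /\ forall x : F, w x%:A = v x *+ e.

Definition local_emb (F : fieldType) (F' : fieldExtType F)
    (Fh : completions F) (Fh' : completions F') (v : place F) (w : place F') :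
    Fh v -> Fh' w :=
  cont_ext (@cval _ _ _ (Fh' w)) (fun a : F => cemb (Fh' w) a%:A).
Arguments local_emb {F F'} Fh Fh' v w.

Section LocalField.
Context {F : fieldType} {v : place F} (Fv : completion v).

Definition integer : set Fv := [set x | val_ge (@cval _ _ _ Fv) 0 x].
Definition maxideal : set Fv := [set x | val_ge (@cval _ _ _ Fv) 1 x].

Definition residue_field : set (set Fv) :=
  [set [set y | maxideal (y - x)] | x in integer].
Definition residue_card : nat := #|` fset_set residue_field|%fset.

End LocalField.

(* The field of constants of a finite extension of Fq(t) is exactly Fq. *)
Definition full_constants (Fq : finFieldType)
    (F : fieldExtType {fraction {poly Fq}}) : Prop :=
  let cst (c : Fq) : F := (tofrac c%:P)%:A in
  forall x : F, algebraicOver cst x -> exists c, x = cst c.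

(* A completion of an algebraic closure of a complete discretely valued field,
   valued by Q so as to extend the given valuation. *)
Record Cinfinity (F : fieldType) (oo : place F) (Foo : completion oo) := CInfty {
  algcl : fieldType;
  algcl_emb : {rmorphism Foo -> algcl};
  algcl_closed : GRing.closed_field_axiom algcl;
  algcl_alg : forall x, algebraicOver algcl_emb x;
  algcl_val : algcl -> rat;
  algcl_valP : valuation algcl_val;
  algcl_val_emb : forall x, algcl_val (algcl_emb x) = (cval x)%:~R;
  Cinf_sort :> completion algcl_val }.

Definition Cinf_emb (F : fieldType) (oo : place F) (Foo : completion oo)
  (C : Cinfinity Foo) (x : Foo) : C := cemb C (algcl_emb C x).

Record GL (r : nat) (R : comPzRingType) := MkGL {
  GLmx :> 'M[R]_r;
  GLimx : 'M[R]_r;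
  GLmxV : GLmx *m GLimx = 1%:M;
  GLVmx : GLimx *m GLmx = 1%:M }.

HB.instance Definition _ r R := gen_eqMixin (GL r R).
HB.instance Definition _ r R := gen_choiceMixin (GL r R).

Section GLGroup.
Context {r : nat} {R : comPzRingType}.
Implicit Types g h : GL r R.

Lemma GL_inj g h : GLmx g = GLmx h -> g = h.
Proof.
case: g h => [a a' ha ha'] [b b' hb hb'] /= e; subst b.
have e' : a' = b' by rewrite -[a']mulmx1 -hb mulmxA ha' mul1mx.
by subst b'; rewrite (Prop_irrelevance ha hb) (Prop_irrelevance ha' hb').
Qed.

Definition GLone : GL r R := MkGL (mulmx1 1%:M) (mulmx1 1%:M).
Definition GLinv g : GL r R := MkGL (GLVmx g) (GLmxV g).

Lemma GLmul_subproof1 g h : (g *m h) *m (GLimx h *m GLimx g) = 1%:M.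
Proof. by rewrite mulmxA -(mulmxA g) GLmxV mulmx1 GLmxV. Qed.
Lemma GLmul_subproof2 g h : (GLimx h *m GLimx g) *m (g *m h) = 1%:M.
Proof. by rewrite mulmxA -(mulmxA (GLimx h)) GLVmx mulmx1 GLVmx. Qed.
Definition GLmul g h : GL r R := MkGL (GLmul_subproof1 g h) (GLmul_subproof2 g h).

Lemma GLmulA : associative GLmul.
Proof. by move=> x y z; apply: GL_inj; rewrite /= mulmxA. Qed.
Lemma GLmul1 : left_id GLone GLmul.
Proof. by move=> x; apply: GL_inj; rewrite /= mul1mx. Qed.
Lemma GL1mul : right_id GLone GLmul.
Proof. by move=> x; apply: GL_inj; rewrite /= mulmx1. Qed.
Lemma GLmulV : left_inverse GLone GLinv GLmul.
Proof. by move=> x; apply: GL_inj; rewrite /= GLVmx. Qed.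
Lemma GLVmul : right_inverse GLone GLinv GLmul.
Proof. by move=> x; apply: GL_inj; rewrite /= GLmxV. Qed.

HB.instance Definition _ :=
  isGroup.Build (GL r R) GLmulA GLmul1 GL1mul GLmulV GLVmul.

Lemma GLmxM g h : GLmx (g * h)%g = g *m h. Proof. by []. Qed.
Lemma GLmx1 : GLmx (1%g : GL r R) = 1%:M. Proof. by []. Qed.

End GLGroup.

Section GLMap.
Context {r : nat} {R S : comPzRingType} (f : {rmorphism R -> S}).

Lemma GLmap_subproof1 (g : GL r R) : map_mx f g *m map_mx f (GLimx g) = 1%:M.
Proof. by rewrite -map_mxM GLmxV map_mx1. Qed.
Lemma GLmap_subproof2 (g : GL r R) : map_mx f (GLimx g) *m map_mx f g = 1%:M.
Proof. by rewrite -map_mxM GLVmx map_mx1. Qed.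
Definition GLmap (g : GL r R) : GL r S :=
  MkGL (GLmap_subproof1 g) (GLmap_subproof2 g).

Lemma GLmapM : {morph GLmap : g h / (g * h)%g}.
Proof. by move=> g h; apply: GL_inj; rewrite /= map_mxM. Qed.
Lemma GLmap1 : GLmap 1%g = 1%g.
Proof. by apply: GL_inj; rewrite /= map_mx1. Qed.
Lemma GLmapV : {morph GLmap : g / (g^-1)%g}.
Proof. by move=> g; apply: GL_inj. Qed.

End GLMap.

Record subgroup (G : groupType) := Subgroup {
  sgset :> set G;
  sg1 : sgset 1%g;
  sgM : forall x y, sgset x -> sgset y -> sgset (x * y)%g;
  sgV : forall x, sgset x -> sgset (x^-1)%g }.

Section Subgroups.
Context {G : groupType}.
Implicit Types (H K : subgroup G) (g : G).

Lemma capsg_subproof H K (A := H `&` K) :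
  [/\ A 1%g, forall x y, A x -> A y -> A (x * y)%g & forall x, A x -> A (x^-1)%g].
Proof.
split; first by split; exact: sg1.
- by move=> x y [? ?] [? ?]; split; exact: sgM.
- by move=> x [? ?]; split; exact: sgV.
Qed.
Definition capsg H K : subgroup G :=
  let: And3 a b c := capsg_subproof H K in Subgroup a b c.

Lemma conjsg_subproof K g (A := [set (g^-1 * k * g)%g | k in K]) :
  [/\ A 1%g, forall x y, A x -> A y -> A (x * y)%g & forall x, A x -> A (x^-1)%g].
Proof.
split; first by exists 1%g; [exact: sg1 | rewrite mulg1 mulVg].
- move=> _ _ [x hx <-] [y hy <-]; exists (x * y)%g; first exact: sgM.
  by rewrite !mulgA -(mulgA _ g) mulgV mulg1.
- move=> _ [x hx <-]; exists (x^-1)%g; first exact: sgV.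
  by rewrite !invgM invgK mulgA.
Qed.
(* g^-1 K g *)
Definition conjsg K g : subgroup G :=
  let: And3 a b c := conjsg_subproof K g in Subgroup a b c.

Definition lcosets_in K H : set (set G) :=
  [set [set (x * h)%g | h in H] | x in K].

Definition cyclic_subgroup g : set G :=
  [set (g ^+ n)%g | n in [set: nat]] `|` [set (g ^- n)%g | n in [set: nat]].

End Subgroups.

Section PGL.
Context {r : nat} {K : fieldType}.

Definition GL_scalar_rel (g h : GL r K) : bool :=
  `[< exists2 c : K, c != 0 & GLmx h = c *: GLmx g >].

Lemma GL_scalar_refl : reflexive GL_scalar_rel.
Proof. by move=> g; apply/asboolP; exists 1; rewrite ?oner_eq0 ?scale1r. Qed.
Lemma GL_scalar_sym : symmetric GL_scalar_rel.
Proof.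
have imp g h : GL_scalar_rel g h -> GL_scalar_rel h g.
  move=> /asboolP[c c0 e]; apply/asboolP; exists c^-1; first by rewrite invr_eq0.
  by rewrite e scalerA mulVf ?scale1r.
by move=> g h; apply/idP/idP; exact: imp.
Qed.
Lemma GL_scalar_trans : transitive GL_scalar_rel.
Proof.
move=> h g k /asboolP[c c0 e] /asboolP[d d0 e']; apply/asboolP.
by exists (d * c); [rewrite mulf_neq0 | rewrite e' e scalerA].
Qed.

Canonical GL_scalar_equiv :=
  EquivRel GL_scalar_rel GL_scalar_refl GL_scalar_sym GL_scalar_trans.

Definition PGL := {eq_quot GL_scalar_equiv}.
HB.instance Definition _ := Choice.on PGL.

Definition toPGL (g : GL r K) : PGL := \pi_{eq_quot GL_scalar_equiv} g.
Definition reprPGL (x : PGL) : GL r K := repr (x : {eq_quot GL_scalar_equiv}).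

Lemma reprPGLK : cancel reprPGL toPGL. Proof. exact: reprK. Qed.

Lemma toPGL_eq g h :
  toPGL g = toPGL h <-> exists2 c : K, c != 0 & GLmx h = c *: GLmx g.
Proof.
rewrite /toPGL; split; first by move/eqmodP => /asboolP.
by move=> e; apply/eqmodP/asboolP.
Qed.

Definition PGLone : PGL := toPGL 1%g.
Definition PGLmul (x y : PGL) : PGL := toPGL (reprPGL x * reprPGL y)%g.
Definition PGLinv (x : PGL) : PGL := toPGL (reprPGL x)^-1%g.

Lemma reprPGL_pi g :
  exists2 c : K, c != 0 & GLmx (reprPGL (toPGL g)) = c *: GLmx g.
Proof. by apply/toPGL_eq; rewrite reprPGLK. Qed.

Lemma toPGLM : {morph toPGL : g h / (g * h)%g >-> PGLmul g h}.
Proof.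
move=> g h; apply/toPGL_eq.
have [c c0 ec] := reprPGL_pi g; have [d d0 ed] := reprPGL_pi h.
exists (c * d); first by rewrite mulf_neq0.
by rewrite !GLmxM ec ed -scalemxAl -scalemxAr scalerA.
Qed.

Lemma PGLmulA : associative PGLmul.
Proof.
move=> x y z; rewrite -[x]reprPGLK -[y]reprPGLK -[z]reprPGLK.
by rewrite -!toPGLM mulgA.
Qed.
Lemma PGLmul1 : left_id PGLone PGLmul.
Proof. by move=> x; rewrite -[x]reprPGLK -toPGLM mul1g. Qed.
Lemma PGL1mul : right_id PGLone PGLmul.
Proof. by move=> x; rewrite -[x]reprPGLK -toPGLM mulg1. Qed.
Lemma PGLmulV : left_inverse PGLone PGLinv PGLmul.
Proof. by move=> x; rewrite -[x in PGLmul _ x]reprPGLK -toPGLM mulVg. Qed.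
Lemma PGLVmul : right_inverse PGLone PGLinv PGLmul.
Proof. by move=> x; rewrite -[x in PGLmul x _]reprPGLK -toPGLM mulgV. Qed.

HB.instance Definition _ :=
  isGroup.Build PGL PGLmulA PGLmul1 PGL1mul PGLmulV PGLVmul.

End PGL.
Arguments PGL : clear implicits.

Section Bounded.
Context {r : nat} {F : fieldType} {v : place F} {Fv : completion v}.

(* A subset of the affine variety GL_r is bounded when the coordinate functions
   (entries of g and of its inverse) are; a subset of PGL_r is bounded when it
   is contained in the image of a bounded subset of GL_r. *)
Definition GL_bounded (B : set (GL r Fv)) : Prop :=
  exists n : int, forall g i j, B g ->
    val_ge (@cval _ _ _ Fv) n (g i j) /\ val_ge (@cval _ _ _ Fv) n ((g^-1)%g i j).

Definition PGL_bounded (B : set (PGL r Fv)) : Prop :=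
  exists2 B' : set (GL r Fv), GL_bounded B' & B `<=` [set toPGL g | g in B'].

End Bounded.

(* Places outside S; for S = {oo} these are the primes. *)
Definition primes_off (F : fieldType) (S : set (place F)) :=
  {v : place F | v \notin S}.

Record adele (F : fieldType) (Fh : completions F) (S : set (place F)) := Adele {
  acomp :> forall v : primes_off S, Fh (val v);
  acompP : finite_set [set v | ~ integer (acomp v)] }.

Section AdeleRing.
Context {F : fieldType} (Fh : completions F) (S : set (place F)).
Local Notation A := (adele Fh S).
Implicit Types (a b : A) (v : primes_off S).

HB.instance Definition _ := gen_eqMixin A.
HB.instance Definition _ := gen_choiceMixin A.

Lemma adeleP a b : (forall v, a v = b v) -> a = b.
Proof.
case: a b => [a ha] [b hb] /= e.
have eab : a = b by apply: functional_extensionality_dep.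
by subst b; rewrite (Prop_irrelevance ha hb).
Qed.

Lemma val_mul_ge0 (v : place F) (x y : Fh v) :
  integer x -> integer y -> integer (x * y).
Proof.
rewrite /integer /val_ge /= => hx hy.
have [->|x0] := eqVneq x 0; first by rewrite mul0r; left.
have [->|y0] := eqVneq y 0; first by rewrite mulr0; left.
case: hx => [/eqP|hx]; first by rewrite (negPf x0).
case: hy => [/eqP|hy]; first by rewrite (negPf y0).
by right; have [_ -> // _] := cvalP (Fh v); rewrite addr_ge0.
Qed.

Lemma val_1_ge0 (v : place F) : integer (1 : Fh v).
Proof.
right; have [_ M _] := cvalP (Fh v).
have := M 1 1 (oner_neq0 _) (oner_neq0 _).
by rewrite mulr1 => /eqP; rewrite -subr_eq0 opprD addNKr oppr_eq0 => /eqP ->.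
Qed.

Lemma val_opp_ge0 (v : place F) (x : Fh v) : integer x -> integer (- x).
Proof.
move=> hx; rewrite -mulN1r; apply: val_mul_ge0 => //; right.
have [_ M _] := cvalP (Fh v).
have n0 : (-1 : Fh v) != 0 by rewrite oppr_eq0 oner_eq0.
have := M (-1) (-1) n0 n0; rewrite mulrNN mulr1.
have := M 1 1 (oner_neq0 _) (oner_neq0 _).
rewrite mulr1 => /eqP; rewrite -subr_eq0 opprD addNKr oppr_eq0 => /eqP ->.
by move=> /eqP; rewrite -mulr2n eq_sym mulrn_eq0 /= => /eqP ->.
Qed.

Lemma adele_const_subproof (f : forall v, Fh (val v)) :
  (forall v, integer (f v)) -> finite_set [set v | ~ integer (f v)].
Proof.
by move=> h; apply: (sub_finite_set _ (finite_set0 _)) => v /(_ (h v)).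
Qed.

Definition adele0 : A := Adele (adele_const_subproof (fun v =>
  or_introl (erefl (0 : Fh (val v))))).
Definition adele1 : A := Adele (adele_const_subproof (fun v => val_1_ge0 (val v))).

Lemma adele_opp_subproof a : finite_set [set v | ~ integer (- a v)].
Proof.
apply: sub_finite_set (acompP a) => v /= h h'; apply: h; exact: val_opp_ge0.
Qed.
Definition adele_opp a : A := Adele (adele_opp_subproof a).

Lemma adele_op_subproof (op : forall v, Fh (val v) -> Fh (val v) -> Fh (val v)) a b :
  (forall v (x y : Fh (val v)), integer x -> integer y -> integer (op v x y)) ->
  finite_set [set v | ~ integer (op v (a v) (b v))].
Proof.
move=> hop; have hU : finite_set ([set v | ~ integer (a v)] `|` [set v | ~ integer (b v)]).
  by rewrite finite_setU; split; exact: acompP.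
apply: sub_finite_set hU => v /= h; apply: contrapT => /not_orP[/contrapT ha /contrapT hb].
by apply: h; exact: hop.
Qed.
Definition adele_add a b : A :=
  Adele (adele_op_subproof (op := fun _ => +%R) a b
    (fun v x y => let: And3 _ _ h := cvalP (Fh (val v)) in h 0 x y)).
Definition adele_mul a b : A :=
  Adele (adele_op_subproof (op := fun _ => *%R) a b (fun v => @val_mul_ge0 (val v))).

Lemma adele_addA : associative adele_add.
Proof. by move=> a b c; apply: adeleP => v; exact: addrA. Qed.
Lemma adele_addC : commutative adele_add.
Proof. by move=> a b; apply: adeleP => v; exact: addrC. Qed.
Lemma adele_add0 : left_id adele0 adele_add.
Proof. by move=> a; apply: adeleP => v; exact: add0r. Qed.
Lemma adele_addN : left_inverse adele0 adele_opp adele_add.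
Proof. by move=> a; apply: adeleP => v; exact: addNr. Qed.
HB.instance Definition _ :=
  GRing.isZmodule.Build A adele_addA adele_addC adele_add0 adele_addN.

Lemma adele_mulA : associative adele_mul.
Proof. by move=> a b c; apply: adeleP => v; exact: mulrA. Qed.
Lemma adele_mulC : commutative adele_mul.
Proof. by move=> a b; apply: adeleP => v; exact: mulrC. Qed.
Lemma adele_mul1 : left_id adele1 adele_mul.
Proof. by move=> a; apply: adeleP => v; exact: mul1r. Qed.
Lemma adele_mulD : left_distributive adele_mul adele_add.
Proof. by move=> a b c; apply: adeleP => v; exact: mulrDl. Qed.
HB.instance Definition _ :=
  GRing.Zmodule_isComPzRing.Build A adele_mulA adele_mulC adele_mul1 adele_mulD.

Definition at_place v (a : A) : Fh (val v) := a v.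
HB.instance Definition _ v :=
  GRing.isZmodMorphism.Build A (Fh (val v)) (at_place v) (fun _ _ => erefl).
HB.instance Definition _ v :=
  GRing.isMonoidMorphism.Build A (Fh (val v)) (at_place v) (erefl, fun _ _ => erefl).

Definition GL_at v r (g : GL r A) : GL r (Fh (val v)) := GLmap (at_place v) g.
Definition vec_at v r (x : 'cV[A]_r) : 'cV[Fh (val v)]_r := map_mx (at_place v) x.

(* The adele with component x at v and 0 elsewhere. *)
Definition single_fun v (x : Fh (val v)) (w : primes_off S) : Fh (val w) :=
  if pselect (v = w) is left e then eq_rect v (fun u => Fh (val u)) x w e else 0.
Lemma single_subproof v (x : Fh (val v)) :
  finite_set [set w | ~ integer (single_fun x w)].
Proof.
apply: (sub_finite_set _ (finite_set1 v)) => w /=; rewrite /single_fun.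
by case: pselect => [e _|_ []]; [exact: esym | left].
Qed.
Definition single v (x : Fh (val v)) : A := Adele (single_subproof x).

(* The restricted product topology: h is close to g when the entries of h - g
   and of h^-1 - g^-1 are integral everywhere and small at finitely many
   given places. *)
Definition GL_close r (T : set (primes_off S)) (n : int) (g h : GL r A) : Prop :=
  forall i j v,
    [/\ integer ((h i j - g i j) v),
        integer (((h^-1)%g i j - (g^-1)%g i j) v),
        T v -> val_ge (@cval _ _ _ (Fh (val v))) n ((h i j - g i j) v)
      & T v -> val_ge (@cval _ _ _ (Fh (val v))) n
                 (((h^-1)%g i j - (g^-1)%g i j) v)].

Definition GL_open r (U : set (GL r A)) : Prop :=
  forall g, U g -> exists T n, finite_set T /\ GL_close T n g `<=` U.

Lemma GL_openT r : GL_open [set: GL r A].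
Proof. by move=> g _; exists set0, 0; split. Qed.

Lemma val_ge_le (v : place F) (m n : int) (x : Fh v) :
  m <= n -> val_ge (@cval _ _ _ (Fh v)) n x -> val_ge (@cval _ _ _ (Fh v)) m x.
Proof. by move=> mn [->|h]; [left | right; exact: le_trans h]. Qed.

Lemma GL_openI r : setI_closed (@GL_open r).
Proof.
move=> U V oU oV g [Ug Vg].
have [T [n [fT hT]]] := oU g Ug; have [T' [n' [fT' hT']]] := oV g Vg.
exists (T `|` T'), (Num.max n n'); split; first by rewrite finite_setU.
move=> h hh; split; [apply: hT | apply: hT'] => i j v;
  have [h1 h2 h3 h4] := hh i j v; split=> // Tv.
- by apply: val_ge_le (h3 (or_introl Tv)); rewrite le_max lexx.
- by apply: val_ge_le (h4 (or_introl Tv)); rewrite le_max lexx.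
- by apply: val_ge_le (h3 (or_intror Tv)); rewrite le_max lexx orbT.
- by apply: val_ge_le (h4 (or_intror Tv)); rewrite le_max lexx orbT.
Qed.

Lemma GL_open_bigU r (I : Type) (f : I -> set (GL r A)) :
  (forall i, GL_open (f i)) -> GL_open (\bigcup_i f i).
Proof.
move=> of_ g [i _ fg]; have [T [n [fT hT]]] := of_ i g fg.
by exists T, n; split=> // h /hT; exists i.
Qed.

HB.instance Definition _ r :=
  isOpenTopological.Build (GL r A) (@GL_openT r) (@GL_openI r) (@GL_open_bigU r).

Lemma GL_openE r (U : set (GL r A)) : open U = GL_open U.
Proof. by []. Qed.

End AdeleRing.

(* Injective K-linear maps K^r -> C, where C is a K-algebra through c. *)
Record period (r : nat) (K C : fieldType) (c : K -> C) := Period {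
  period_fun :> 'cV[K]_r -> C;
  period_linear : forall a x y,
    period_fun (a *: x + y) = c a * period_fun x + period_fun y;
  period_inj : injective period_fun }.

Section ModularVariety.
Context {F : fieldType} {Fh : completions F} {oo : place F} {r : nat}
        {C : fieldType} {c : Fh oo -> C}.

Local Notation GA := (GL r (adele Fh [set oo])).

Definition dmv_pair := (period r c * GA)%type.
HB.instance Definition _ := gen_eqMixin (period r c).
HB.instance Definition _ := gen_choiceMixin (period r c).

(* (omega, h) ~ (l * omega o T^-1, T h k), with T in GL_r(F), k in K and
   l in C^*; the latter accounts for the passage to classes in Omega^r. *)
Definition dmv_rel (K : subgroup GA) (x y : dmv_pair) : bool :=
  `[< exists (T : GL r F) (l : C) (k : GA), [/\ l != 0, sgset K k,
        forall z, y.1 z = l * x.1 (GLmap (cemb (Fh oo)) T^-1%g *m z)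
      & forall v, GL_at v y.2 =
          (GLmap (cemb (Fh (val v))) T * GL_at v x.2 * GL_at v k)%g ] >].

Lemma dmv_refl K : reflexive (dmv_rel K).
Proof.
move=> x; apply/asboolP; exists 1%g, 1, 1%g; split.
- exact: oner_neq0.
- exact: sg1.
- by move=> z; rewrite invg1 GLmap1 mul1mx mul1r.
- by move=> v; rewrite /GL_at !GLmap1 mul1g mulg1.
Qed.

Lemma dmv_sym K : symmetric (dmv_rel K).
Proof.
have imp x y : dmv_rel K x y -> dmv_rel K y x.
  move=> /asboolP[T [l [k [l0 Kk e1 e2]]]]; apply/asboolP.
  exists (T^-1)%g, l^-1, (k^-1)%g; split.
  - by rewrite invr_eq0.
  - exact: sgV.
  - move=> z; rewrite e1 mulKf // mulmxA -GLmxM -GLmapM invgK mulVg GLmap1.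
    by rewrite mul1mx.
  - move=> v; rewrite e2 /GL_at !GLmapV -!mulgA.
    by rewrite mulgV mulg1 !mulgA mulVg mul1g.
by move=> x y; apply/idP/idP; exact: imp.
Qed.

Lemma dmv_trans K : transitive (dmv_rel K).
Proof.
move=> y x z /asboolP[T [l [k [l0 Kk e1 e2]]]] /asboolP[T' [l' [k' [l0' Kk' e1' e2']]]].
apply/asboolP; exists (T' * T)%g, (l' * l), (k * k')%g; split.
- by rewrite mulf_neq0.
- exact: sgM.
- by move=> t; rewrite e1' e1 invgM GLmapM GLmxM mulrA mulmxA.
- by move=> v; rewrite e2' e2 /GL_at !GLmapM !mulgA.
Qed.

Canonical dmv_equiv K :=
  EquivRel (dmv_rel K) (dmv_refl K) (@dmv_sym K) (@dmv_trans K).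

(* The variety S^r_{F,K} is represented by its set of C_oo-points, and its
   closed subvarieties by their sets of C_oo-points, which determine them. *)
Definition dmv (K : subgroup GA) := {eq_quot dmv_equiv K}.
Definition dmv_class (K : subgroup GA) (x : dmv_pair) : dmv K :=
  \pi_{eq_quot dmv_equiv K} x.
Definition dmv_repr (K : subgroup GA) (z : dmv K) : dmv_pair := repr z.

(* [(omega, h)] |-> [(omega, h g^-1)]; independent of the representative when
   K'' is contained in g^-1 K g. *)
Definition hecke_proj (g : GA) (K'' K : subgroup GA) (z : dmv K'') : dmv K :=
  dmv_class K ((dmv_repr z).1, ((dmv_repr z).2 * g^-1)%g).

Definition hecke (K : subgroup GA) (g : GA) (Z : set (dmv K)) : set (dmv K) :=
  let K'' := capsg K (conjsg K g) in
  @hecke_proj g K'' K @` (@hecke_proj 1%g K'' K @^-1` Z).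

End ModularVariety.

Section Subvariety.
Context {F : fieldType} {F' : fieldExtType F} {oo : place F} {oo' : place F'}
        (Fh : completions F) (Fh' : completions F') (r r' : nat).

Local Notation A := (adele Fh [set oo]).
Local Notation A' := (adele Fh' [set oo']).

(* Linearity over the finite adeles of F, which act on those of F' through
   F_v -> F'_w at every w | v. *)
Record adelic_iso := AdelicIso {
  biso :> 'cV[A]_r -> 'cV[A']_r';
  bisoD : forall x y, biso (x + y) = biso x + biso y;
  bisoZ : forall (a : A) x (v : primes_off [set oo]) (w : primes_off [set oo']),
    lies_above (val w) (val v) ->
    vec_at w (biso (a *: x)) =
      local_emb Fh Fh' (val v) (val w) (a v) *: vec_at w (biso x);
  biso_bij : bijective biso }.

Variable b : adelic_iso.

(* b K b^-1 `&` GL_r'(A') *)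
Lemma bconj_subproof (K : subgroup (GL r A))
  (H := [set g' : GL r' A' | exists2 k : GL r A, sgset K k &
           forall x, b (k *m x) = g' *m b x]) :
  [/\ H 1%g, forall x y, H x -> H y -> H (x * y)%g & forall x, H x -> H (x^-1)%g].
Proof.
split; first by exists 1%g; [exact: sg1 | move=> x; rewrite !mul1mx].
- move=> g h [k Kk e] [k' Kk' e']; exists (k * k')%g; first exact: sgM.
  by move=> x; rewrite !GLmxM -!mulmxA e e'.
- move=> g [k Kk e]; exists (k^-1)%g; first exact: sgV.
  move=> x; rewrite -[in RHS](mul1mx x) -(@GLmx1 r A) -(mulgV k) GLmxM -mulmxA e.
  by rewrite mulmxA -GLmxM mulVg mul1mx.
Qed.
Definition bconj (K : subgroup (GL r A)) : subgroup (GL r' A') :=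
  let: And3 x y z := bconj_subproof K in Subgroup x y z.

Section Iota.
Context {C : fieldType} (c : Fh oo -> C) (c' : Fh' oo' -> C).

Record rational_iso := RationalIso {
  phi :> 'cV[F]_r -> 'cV[F']_r';
  phi_linear : forall (a : F) x y, phi (a *: x + y) = a%:A *: phi x + phi y;
  phi_bij : bijective phi }.

(* The F_v-linear extension F_v^r -> F'_w^r' of phi. *)
Definition phi_ext (f : rational_iso) (v : place F) (w : place F')
    (x : 'cV[Fh v]_r) : 'cV[Fh' w]_r' :=
  \sum_i local_emb Fh Fh' v w (x i ord0) *:
    map_mx (cemb (Fh' w)) (f (delta_mx i ord0)).

(* The graph of iota^{F'}_{F,b}: [h] is the element phi^-1 o h' o b of
   GL_r(A), and [omega] is omega' o phi. *)
Definition iota_graph (K : subgroup (GL r A))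
    (z' : dmv (c := c') (bconj K)) (z : dmv (c := c) K) : Prop :=
  exists (f : rational_iso) (omega' : period r' c') (h' : GL r' A')
         (omega : period r c) (h : GL r A),
    [/\ z' = dmv_class (bconj K) (omega', h'),
        z = dmv_class K (omega, h),
        forall x, omega x = omega' (phi_ext f oo' x)
      & forall x (v : primes_off [set oo]) (w : primes_off [set oo']),
          lies_above (val w) (val v) ->
          phi_ext f (val w) (vec_at v (h *m x)) = vec_at w (h' *m b x)].

Definition subvariety (K : subgroup (GL r A)) : set (dmv (c := c) K) :=
  [set z | exists z', @iota_graph K z' z].

End Iota.

Section GoodPrime.
Variable p : primes_off [set oo].
Local Notation Fp := (Fh (val p)).

Definition above := {w : primes_off [set oo'] | lies_above (val w) (val p)}.

(* b_p : F_p^r -> (F'_p)^r', where F'_p is the product of the F'_w, w | p. *)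
Definition b_at (x : 'cV[Fp]_r) (w : above) : 'cV[Fh' (val (sval w))]_r' :=
  vec_at (sval w) (b (map_mx (@single _ Fh [set oo] p) x)).

Definition integral_mx m n (x : 'M[Fp]_(m, n)) : Prop := forall i j, integer (x i j).

(* The columns of B form a basis of the A_p-module Lambda. *)
Definition free_lattice (Lambda : set 'cV[Fp]_r) : Prop :=
  exists B : 'M[Fp]_r,
    (forall a : 'cV_r, integral_mx a -> B *m a = 0 -> a = 0) /\
    Lambda = [set B *m a | a in [set a : 'cV_r | integral_mx a]].

Definition congruence_subgroup (Lambda : set 'cV[Fp]_r) : set (GL r Fp) :=
  [set g | [set g *m x | x in Lambda] = Lambda /\
     forall x, Lambda x -> exists (a : Fp) y,
       [/\ maxideal a, Lambda y & g *m x - x = a *: y]].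

(* A'_p = A' (x)_A A_p, as a subring of F'_p = prod_{w | p} F'_w, is the product
   of the valuation rings A'_w. *)
Definition Aprime_submodule (M : set (forall w : above, 'cV[Fh' (val (sval w))]_r')) :
    Prop :=
  [/\ M (fun _ => 0),
      forall x y, M x -> M y -> M (fun w => x w + y w)
    & forall (a : forall w : above, Fh' (val (sval w))) x,
        (forall w, integer (a w)) -> M x -> M (fun w => a w *: x w)].

(* [F'_w : F_p] = 1 *)
Definition local_degree_one (w : primes_off [set oo']) : Prop :=
  forall y, exists x, local_emb Fh Fh' (val p) (val w) x = y.

(* p is good for the subvariety attached to b when such Lambda, K_p and K^(p)
   exist; they are kept as parameters since K_p is referred to afterwards. *)
Record good_prime (K : subgroup (GL r A)) (Lambda : set 'cV[Fp]_r)
    (Kp : set (GL r Fp)) (Kaway : set (GL r (adele Fh [set oo; val p]))) : Prop :=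
  GoodPrime {
    good_free : free_lattice Lambda;
    good_Kp : Kp = congruence_subgroup Lambda;
    good_K : forall k : GL r A, sgset K k <-> Kp (GL_at p k) /\
      exists2 k' : GL r (adele Fh [set oo; val p]), Kaway k' &
        forall (v : place F) (hv : v \notin [set oo])
          (hv' : v \notin [set oo; val p]),
          GL_at (exist _ v hv) k = GL_at (exist _ v hv') k';
    good_split : exists w : above, local_degree_one (sval w);
    good_stable : Aprime_submodule [set b_at x | x in Lambda] }.

End GoodPrime.
End Subvariety.
Arguments subvariety {F F' oo oo' Fh Fh' r r'} b {C} c c' K.
Arguments good_prime {F F' oo oo' Fh Fh' r r'} b p K Lambda Kp Kaway.

(* Main.v *)
Require Import Defs.
From HB Require Import structures.
From mathcomp Require Import all_boot all_order all_algebra all_field.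
From mathcomp Require Import finmap all_classical topology.
From mathcomp Require Import ring zify.

(* Since F'_p' = F_p, the lattice b_p(Lambda) has a direct summand over the place
   p', cut out by an idempotent E that is integral on Lambda and transfers every
   endomorphism below E to an F'_p'-linear one. A unit entry of E yields a vector u
   of the summand and a form phi with phi u = 1, both integral; g multiplies the
   line of u by a uniformizer pi and is the identity on ker phi. Writing
   k = 1 + pi m, the element k of K lies in g^-1 K g iff m u lies in the line of u
   modulo pi, whence the index (the residue field is finite because K is compact).
   Modulo pi the powers of k g stay nonzero on ker phi, while those of pi (k g)^-1
   fix u, so no scaling bounds both. Finally, [omega' o phi, phi^-1 h' b] is the
   image under pi_g of [omega' o phi, phi^-1 h' g' b], which pi_1 maps into X. *)

Set Implicit Arguments.
Unset Strict Implicit.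
Unset Printing Implicit Defensive.

Import Order.TTheory GRing.Theory Num.Theory.
Local Open Scope ring_scope.
Local Open Scope classical_set_scope.
Local Open Scope card_scope.

(** Only a line of the summand is scaled: the block that conjugation divides by [pi] is then a
    single column in the kernel of [phi], with r - 1 free coordinates modulo [pi], and this is the
    exponent in (ii). Scaling the whole summand, of rank r', would give r'(r - r'). The line has to
    lie in the summand at p', where F_p-linear maps are F'_p'-linear. Condition (iii) of a good
    prime enters through one scalar, the idempotent of A'_p at p'. No basis of Lambda adapted to E
    is chosen: [u] and [phi] give the projectors [P = u phi] and [R = 1 - P], and the estimates are
    congruences on the four blocks that these cut out. On the adelic side the obstacle is that [b]
    is controlled only along pairs w | v and through [local_emb], a map given by a closure;
    multiplying by adeles that are 1 at one place and 0 elsewhere localizes [b], provided that each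
    prime of F' lies above one of F. *)

Section Valuation.
Context {K : fieldType} {v : K -> int} (vP : valuation v).

Lemma valM x y : x != 0 -> y != 0 -> v (x * y) = v x + v y.
Proof. by case: vP => _ h _; exact: h. Qed.

Lemma val1 : v 1 = 0.
Proof.
have := valM (oner_neq0 K) (oner_neq0 K); rewrite mulr1.
by move=> /eqP; rewrite -subr_eq0 opprD addNKr oppr_eq0 => /eqP ->.
Qed.

Lemma valV x : x != 0 -> v x^-1 = - v x.
Proof.
move=> x0; apply/eqP; rewrite -addr_eq0 addrC -valM ?invr_eq0 //.
by rewrite mulfV // val1.
Qed.

Lemma valN1 : v (- 1) = 0.
Proof.
have n0 : - 1 != 0 :> K by rewrite oppr_eq0 oner_eq0.
have := valM n0 n0; rewrite mulrNN mulr1 val1 => /eqP.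
by rewrite -mulr2n eq_sym mulrn_eq0 /= => /eqP.
Qed.

Lemma valX x n : x != 0 -> v (x ^+ n) = v x *+ n.
Proof.
move=> x0; elim: n => [|n IHn]; first by rewrite expr0 val1.
by rewrite exprS valM ?expf_neq0 // IHn mulrS.
Qed.

Lemma val_ge0 n : val_ge v n 0. Proof. by left. Qed.
Hint Resolve val_ge0 : core.

Lemma val_ge_le m n x : m <= n -> val_ge v n x -> val_ge v m x.
Proof. by move=> mn [->|h]; [left | right; exact: le_trans h]. Qed.

Lemma val_geE n x : x != 0 -> val_ge v n x -> n <= v x.
Proof. by move=> /eqP x0 []. Qed.

Lemma val_geD n x y : val_ge v n x -> val_ge v n y -> val_ge v n (x + y).
Proof. by case: vP => _ _ h; exact: h. Qed.

Lemma val_geM m n x y : val_ge v m x -> val_ge v n y -> val_ge v (m + n) (x * y).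
Proof.
have [->|x0] := eqVneq x 0; first by rewrite mul0r.
have [->|y0] := eqVneq y 0; first by rewrite mulr0.
move=> /(val_geE x0) hx /(val_geE y0) hy.
by right; rewrite valM // lerD.
Qed.

Lemma val_ge1 : val_ge v 0 1. Proof. by right; rewrite val1. Qed.

Lemma val_geN n x : val_ge v n x -> val_ge v n (- x).
Proof.
move=> hx; rewrite -mulN1r -[n]add0r; apply: val_geM => //.
by right; rewrite valN1.
Qed.

Lemma val_geB n x y : val_ge v n x -> val_ge v n y -> val_ge v n (x - y).
Proof. by move=> hx hy; apply/val_geD/val_geN. Qed.

Lemma val_ge_sum n (I : Type) (s : seq I) (P : pred I) (f : I -> K) :
  (forall i, P i -> val_ge v n (f i)) -> val_ge v n (\sum_(i <- s | P i) f i).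
Proof. by move=> h; apply: big_ind => //; exact: val_geD. Qed.

Lemma val_ge_all_eq0 x : (forall n : nat, val_ge v n%:Z x) -> x = 0.
Proof.
move=> h; apply: contrapT => /eqP x0.
have := val_geE x0 (h `|v x|.+1); lia.
Qed.

Definition mx_ge (n : int) m1 m2 (M : 'M[K]_(m1, m2)) : Prop :=
  forall i j, val_ge v n (M i j).

Lemma mx_ge0 n m1 m2 : mx_ge n (0 : 'M_(m1, m2)).
Proof. by move=> i j; rewrite mxE. Qed.

Lemma mx_ge_le m n m1 m2 (M : 'M_(m1, m2)) : m <= n -> mx_ge n M -> mx_ge m M.
Proof. by move=> mn h i j; apply: val_ge_le (h i j). Qed.

Lemma mx_geD n m1 m2 (M N : 'M_(m1, m2)) : mx_ge n M -> mx_ge n N -> mx_ge n (M + N).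
Proof. by move=> hM hN i j; rewrite mxE; apply: val_geD. Qed.

Lemma mx_geN n m1 m2 (M : 'M_(m1, m2)) : mx_ge n M -> mx_ge n (- M).
Proof. by move=> hM i j; rewrite mxE; apply: val_geN. Qed.

Lemma mx_geB n m1 m2 (M N : 'M_(m1, m2)) : mx_ge n M -> mx_ge n N -> mx_ge n (M - N).
Proof. by move=> hM hN; apply/mx_geD/mx_geN. Qed.

Lemma mx_geM m n m1 m2 m3 (M : 'M_(m1, m2)) (N : 'M_(m2, m3)) :
  mx_ge m M -> mx_ge n N -> mx_ge (m + n) (M *m N).
Proof.
by move=> hM hN i j; rewrite mxE; apply: val_ge_sum => k _; apply: val_geM.
Qed.

Lemma mx_geZ m n m1 m2 a (M : 'M_(m1, m2)) :
  val_ge v m a -> mx_ge n M -> mx_ge (m + n) (a *: M).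
Proof. by move=> ha hM i j; rewrite mxE; apply: val_geM. Qed.

Lemma mx_ge1 m : mx_ge 0 (1%:M : 'M_m).
Proof.
by move=> i j; rewrite mxE; case: (i == j) => //=; apply: val_ge1.
Qed.

Lemma mx_ge_bound m1 m2 (M : 'M_(m1, m2)) : exists n, mx_ge n M.
Proof.
exists (- \sum_i \sum_j `|v (M i j)|) => i j; right.
have h : `|v (M i j)| <= \sum_i \sum_j `|v (M i j)|.
  rewrite (bigD1 i) //= (bigD1 j) //= -addrA ler_wpDr // addr_ge0 //.
    by apply: sumr_ge0.
  by apply: sumr_ge0 => k _; apply: sumr_ge0.
by have := ler_norm (- v (M i j)); rewrite normrN; lia.
Qed.

Lemma mx_ge_delta m1 m2 (i : 'I_m1) (j : 'I_m2) : mx_ge 0 (delta_mx i j).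
Proof.
by move=> k l; rewrite mxE; case: (_ && _) => //=; apply: val_ge1.
Qed.

End Valuation.
Arguments mx_ge {K} v n {m1 m2} M.
Arguments mx_ge1 {K v} vP {m}.

Section GLExtra.
Context {r : nat} {R : comPzRingType}.
Implicit Types (M N : 'M[R]_r).

Lemma GL1D_subproof M N : M + N + M *m N = 0 -> (1%:M + M) *m (1%:M + N) = 1%:M.
Proof.
move=> h; rewrite mulmxDl mul1mx mulmxDr mulmx1 -[RHS]addr0 -h -!addrA.
by congr (_ + _); rewrite addrCA.
Qed.

(** [N] is the quasi-inverse of [M]: homotheties and coset representatives are the identity plus a
    perturbation, and inverses are checked on the perturbations. *)
Definition GL1D M N (h : M + N + M *m N = 0) (h' : N + M + N *m M = 0) : GL r R :=
  MkGL (GL1D_subproof h) (GL1D_subproof h').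

Lemma GLimx_unique (g : GL r R) M : GLmx g *m M = 1%:M -> M = GLmx g^-1%g.
Proof. by move=> h; rewrite -[M]mul1mx -(GLVmx g) -mulmxA h mulmx1. Qed.

End GLExtra.

(** * Conjugation by a homothety, and its powers, over a valued field *)

Section Congruence.
Context {K : fieldType} {v : K -> int} (vP : valuation v) {r : nat}.
Implicit Types (M N E : 'M[K]_r) (k g : GL r K).

(** If every entry had positive valuation, [E = E^n] would be divisible by every power of a
    uniformizer, hence zero. *)
Lemma idempotent_unit_entry E : E *m E = E -> mx_ge v 0 E -> E != 0 ->
  exists i j, E i j != 0 /\ v (E i j) = 0.
Proof.
move=> EE E_int E0; apply: contrapT => no_unit.
have E1 : mx_ge v 1 E.
  move=> i j; have [-> | ij0] := eqVneq (E i j) 0; first by left.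
  have := val_geE ij0 (E_int i j); rewrite le_eqVlt => /orP[/eqP ij|?].
    by case: no_unit; exists i, j.
  by right; lia.
have En (n : nat) : mx_ge v n%:Z E.
  elim: n => [|n IHn] //; rewrite -EE intS; exact: mx_geM.
move/eqP: E0; apply; apply/matrixP => i j; rewrite mxE.
by apply: (val_ge_all_eq0 (v := v)) => n; apply: En.
Qed.

(* An integral nonzero idempotent has a unit entry, in row i and column j say;
   then u is its column j and phi the multiple of its row i with entry 1 at j. *)
Lemma idempotent_split E : E *m E = E -> mx_ge v 0 E -> E != 0 ->
  exists (u : 'cV_r) (phi : 'rV_r) (j : 'I_r),
    [/\ mx_ge v 0 u, mx_ge v 0 phi, phi *m u = 1%:M, phi 0 j = 1
      & E *m u = u /\ phi *m E = phi].
Proof.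
move=> EE E_int E0; have [i [j [ij0 vij]]] := idempotent_unit_entry EE E_int E0.
exists (col j E), ((E i j)^-1 *: row i E), j; split.
- by move=> k l; rewrite mxE.
- rewrite -[0]addr0; apply: mx_geZ => //; first by right; rewrite valV // vij.
  by move=> k l; rewrite mxE.
- apply/matrixP => k l; rewrite !ord1 -scalemxAl mxE.
  have -> : (row i E *m col j E) 0 0 = (E *m E) i j.
    by rewrite !mxE; apply: eq_bigr => m _; rewrite !mxE.
  by rewrite EE mulVf // !mxE.
- by rewrite !mxE mulVf.
- split; first by rewrite colE mulmxA EE.
  by rewrite -scalemxAl rowE -mulmxA EE.
Qed.

(** The principal congruence subgroup modulo the maximal ideal. Symmetry in [k] and its inverse
    makes it pass to inverses at once and keeps determinants out. *)
Definition cong1 k : Prop :=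
  mx_ge v 1 (GLmx k - 1%:M) /\ mx_ge v 1 (GLmx k^-1%g - 1%:M).

Lemma cong1_int k : cong1 k -> mx_ge v 0 k.
Proof.
case=> h _; rewrite -[GLmx k](subrK 1%:M); refine (mx_geD vP _ (mx_ge1 vP)).
exact: mx_ge_le h.
Qed.

Lemma cong1V k : cong1 k -> cong1 k^-1%g.
Proof. by case=> h h'; split; rewrite ?invgK. Qed.

Lemma cong1M k l : cong1 k -> cong1 l -> cong1 (k * l)%g.
Proof.
have H (a b : GL r K) : mx_ge v 1 (GLmx a - 1%:M) -> mx_ge v 1 (GLmx b - 1%:M) ->
    mx_ge v 1 (GLmx (a * b)%g - 1%:M).
  move=> ha hb; rewrite GLmxM -(subrK (GLmx a) (a *m b)) -[X in _ *m _ - X]mulmx1.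
  rewrite -mulmxBr -addrA; apply: mx_geD => //.
  apply: (mx_geM vP (m := 0) (n := 1)) => //; rewrite -[GLmx a](subrK 1%:M).
  refine (mx_geD vP _ (mx_ge1 vP)); exact: mx_ge_le ha.
by case=> h1 h2 [h3 h4]; split; [|rewrite invgM]; apply: H.
Qed.

Variables (pi : K) (v_pi : v pi = 1).

Lemma uniformizer_neq0 : pi != 0.
Proof. by apply: contra_eq_neq v_pi => ->; case: vP => -> _ _. Qed.

Lemma uniformizer_exp_ge n : val_ge v n%:Z (pi ^+ n).
Proof. by right; rewrite valX ?uniformizer_neq0 // v_pi natz. Qed.

Lemma uniformizer_ge : val_ge v 1 pi. Proof. by right; rewrite v_pi. Qed.

Lemma uniformizerV_ge : val_ge v (- 1) pi^-1.
Proof. by right; rewrite valV ?uniformizer_neq0 // v_pi. Qed.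

Section Homothety.
Variables (u : 'cV[K]_r) (phi : 'rV[K]_r).
Hypotheses (u_int : mx_ge v 0 u) (phi_int : mx_ge v 0 phi) (phi_u : phi *m u = 1%:M).

Local Notation P := (u *m phi).
Local Notation R := (1%:M - u *m phi).

Lemma mulPP : P *m P = P.
Proof. by rewrite mulmxA -(mulmxA u) phi_u mulmx1. Qed.

Lemma homothety_subproof (a : K) : a != 0 ->
  (a - 1) *: P + (a^-1 - 1) *: P + ((a - 1) *: P) *m ((a^-1 - 1) *: P) = 0.
Proof.
move=> a0; rewrite -scalemxAl -scalemxAr mulPP scalerA -!scalerDl.
by rewrite -[RHS](scale0r P); congr (_ *: _); field.
Qed.

Lemma homothety_subproof' (a : K) : a != 0 ->
  (a^-1 - 1) *: P + (a - 1) *: P + ((a^-1 - 1) *: P) *m ((a - 1) *: P) = 0.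
Proof.
move=> a0; rewrite -scalemxAl -scalemxAr mulPP scalerA -!scalerDl.
by rewrite -[RHS](scale0r P); congr (_ *: _); field.
Qed.

(* Multiplication by pi on the line of u, the identity on the kernel of phi. *)
Definition homothety : GL r K :=
  GL1D (homothety_subproof uniformizer_neq0) (homothety_subproof' uniformizer_neq0).

Lemma homothetyE : GLmx homothety = R + pi *: P.
Proof. by rewrite /= scalerBl scale1r addrA addrAC. Qed.

Lemma homothetyVE : GLmx homothety^-1%g = R + pi^-1 *: P.
Proof. by rewrite /= scalerBl scale1r addrA addrAC. Qed.

Lemma P_int : mx_ge v 0 P. Proof. by rewrite -[0]addr0; apply: mx_geM. Qed.
Lemma R_int : mx_ge v 0 R. Proof. apply: mx_geB => //; [exact: mx_ge1 | exact: P_int]. Qed.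

Lemma mulPR : P *m R = 0. Proof. by rewrite mulmxBr mulmx1 mulPP subrr. Qed.
Lemma mulRu : R *m u = 0.
Proof. by rewrite mulmxBl mul1mx -mulmxA phi_u mulmx1 subrr. Qed.
Lemma mulphiR : phi *m R = 0.
Proof. by rewrite mulmxBr mulmx1 mulmxA phi_u mul1mx subrr. Qed.
Lemma mulRR : R *m R = R.
Proof. by rewrite mulmxBr mulmx1 mulmxA mulRu mul0mx subr0. Qed.

(** Conjugation fixes the blocks [RMR] and [PMP] and multiplies [PMR] by [pi], all harmless. It
    divides [RMP] by [pi], and since [phi u = 1] that block is measured by the column [RMu]. *)
Lemma conj_homothety_ge M : mx_ge v 1 M ->
  mx_ge v 1 (GLmx homothety *m M *m GLmx homothety^-1%g) <-> mx_ge v 2 (R *m M *m u).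
Proof.
move=> M1; rewrite homothetyE homothetyVE.
pose X := R *m M *m R + P *m M *m P + pi *: (P *m M *m R).
have X1 : mx_ge v 1 X.
  have h A B : mx_ge v 0 A -> mx_ge v 0 B -> mx_ge v 1 (A *m M *m B).
    by move=> hA hB; apply: (mx_geM vP (m := 1) (n := 0)) => //;
      apply: (mx_geM vP (m := 0) (n := 1)).
  apply: mx_geD => //; first apply: mx_geD => //.
  - by apply: h; exact: R_int.
  - by apply: h; exact: P_int.
  - apply: (mx_ge_le (n := 1 + 1)) => //; apply: mx_geZ => //.
      exact: uniformizer_ge.
    by apply: h; [exact: P_int | exact: R_int].
have -> : (R + pi *: P) *m M *m (R + pi^-1 *: P) = X + pi^-1 *: (R *m M *m P).
  rewrite /X; move: P R => B A.
  rewrite !mulmxDl !mulmxDr -!scalemxAl -!scalemxAr scalerA.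
  rewrite mulfV ?uniformizer_neq0 // scale1r -!addrA; congr (_ + _).
  by rewrite addrC [X in X + _]addrC -addrA.
have pRMu : R *m M *m u = pi *: ((X + pi^-1 *: (R *m M *m P) - X) *m u).
  rewrite addrAC subrr add0r -scalemxAl scalerA mulfV ?uniformizer_neq0 // scale1r.
  by rewrite -!mulmxA phi_u mulmx1.
split=> h.
  rewrite pRMu; apply: (mx_geZ vP (m := 1) (n := 1) uniformizer_ge).
  by apply: (mx_geM vP (m := 1) (n := 0)) => //; apply: mx_geB.
apply: mx_geD => //; apply: (mx_geZ vP (m := -1) (n := 2) uniformizerV_ge).
by rewrite mulmxA; apply: (mx_geM vP (m := 2) (n := 0)).
Qed.

Lemma conj_homothety_cong1 k : cong1 k ->
  cong1 (homothety * k * homothety^-1)%g <-> mx_ge v 2 (R *m (GLmx k - 1%:M) *m u).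
Proof.
move=> kc; have [k1 k1'] := kc.
have E (l : GL r K) : GLmx (homothety * l * homothety^-1)%g - 1%:M =
    GLmx homothety *m (GLmx l - 1%:M) *m GLmx homothety^-1%g.
  rewrite mulmxBr mulmxBl mulmx1 -(GLmxM homothety homothety^-1%g) mulgV GLmx1.
  by rewrite !GLmxM.
(* The inverse half of [cong1] comes for free: [k^-1 - 1] is [-(k - 1)] up to a product of two
   matrices of valuation at least 1, invisible at level 2. *)
have kV : GLmx k^-1%g - 1%:M =
    - (GLmx k - 1%:M) - (GLmx k - 1%:M) *m (GLmx k^-1%g - 1%:M).
  rewrite mulmxBr mulmx1 mulmxBl -GLmxM mulgV GLmx1 mul1mx.
  by rewrite [- (_ - _ - _)]opprB addKr opprB.
split=> [[h _]|h].
  by move: h; rewrite E => /conj_homothety_ge; exact.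
split; first by rewrite E; apply/conj_homothety_ge.
rewrite !invgM invgK mulgA E; apply/conj_homothety_ge => //.
rewrite kV mulmxBr mulmxBl mulmxN mulNmx; apply: mx_geB => //.
  exact: mx_geN.
apply: (mx_geM vP (m := 2) (n := 0)) => //.
apply: (mx_geM vP (m := 0) (n := 2)); first exact: R_int.
exact: (mx_geM vP (m := 1) (n := 1)).
Qed.

(** Modulo [pi ^ 2] the matrix [k^-1 l - 1] is [(l - 1) - (k - 1)], so the column [R (k - 1) u]
    modulo [pi ^ 2] is a complete invariant of the coset of [k]. *)
Lemma conj_homothety_coset k l : cong1 k -> cong1 l ->
  cong1 (homothety * (k^-1 * l) * homothety^-1)%g <->
  mx_ge v 2 (R *m (GLmx l - 1%:M) *m u - R *m (GLmx k - 1%:M) *m u).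
Proof.
move=> kc lc; have klc := cong1M (cong1V kc) lc.
apply: (iff_trans (conj_homothety_cong1 klc)).
have -> : R *m (GLmx (k^-1 * l)%g - 1%:M) *m u =
   (R *m (GLmx l - 1%:M) *m u - R *m (GLmx k - 1%:M) *m u)
   + R *m ((GLmx k^-1%g - 1%:M) *m (GLmx l - GLmx k)) *m u.
  rewrite -mulmxBl -mulmxBr -mulmxDl -mulmxDr; congr (_ *m _ *m _).
  rewrite [in RHS](_ : _ - _ - _ = GLmx l - GLmx k); last by rewrite opprB addrA subrK.
  by rewrite mulmxBl mul1mx [RHS]addrC subrK mulmxBr -(GLmxM k^-1%g k) mulVg GLmx1 GLmxM.
have h2 : mx_ge v 2 (R *m ((GLmx k^-1%g - 1%:M) *m (GLmx l - GLmx k)) *m u).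
  apply: (mx_geM vP (m := 2) (n := 0)) => //.
  apply: (mx_geM vP (m := 0) (n := 2)); first exact: R_int.
  apply: (mx_geM vP (m := 1) (n := 1)); first by case: kc.
  have -> : GLmx l - GLmx k = (GLmx l - 1%:M) - (GLmx k - 1%:M).
    by rewrite opprB addrA subrK.
  by apply: mx_geB => //; [case: lc | case: kc].
split=> h; last exact: mx_geD.
by rewrite -[X in mx_ge _ _ X](addrK (R *m ((GLmx k^-1%g - 1%:M) *m (GLmx l - GLmx k)) *m u));
  apply: mx_geB.
Qed.

(** [homothety] is the identity on the image of [R] and [k] is congruent to 1, so each integral
    factor [k * homothety] fixes that image modulo [pi]. *)
Lemma homothety_power_ge k n : cong1 k ->
  mx_ge v 1 (GLmx ((k * homothety) ^+ n)%g *m R - R).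
Proof.
move=> kc; elim: n => [|n IHn]; first by rewrite expg0 mul1mx subrr; apply: mx_ge0.
set y := (k * homothety)%g; rewrite -/y in IHn.
have -> : GLmx (y ^+ n.+1)%g *m R - R =
   GLmx y *m (GLmx (y ^+ n)%g *m R - R) + (GLmx k - 1%:M) *m R.
  have gR : GLmx homothety *m R = R.
    by rewrite homothetyE mulmxDl mulRR -scalemxAl mulPR scaler0 addr0.
  have yR : GLmx y *m R = GLmx k *m R by rewrite GLmxM -mulmxA gR.
  rewrite (mulmxBr (GLmx y) _ R) yR (mulmxBl (GLmx k) _ R) mul1mx addrA subrK.
  by rewrite mulmxA expgS GLmxM.
apply: mx_geD => //; last first.
  apply: (mx_geM vP (m := 1) (n := 0)); last exact: R_int.
  by case: kc.
apply: (mx_geM vP (m := 0) (n := 1)) => //.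
rewrite GLmxM; apply: (mx_geM vP (m := 0) (n := 0)); first exact: cong1_int.
rewrite homothetyE; apply: mx_geD; rewrite //; first exact: R_int.
apply: (mx_ge_le (n := 1 + 0)) => //; apply: mx_geZ => //; first exact: uniformizer_ge.
exact: P_int.
Qed.

(** The matrix [pi homothety^-1 = pi R + P] is integral and fixes [u]; one factor [pi] for each
    power thus keeps the iterates of the inverse integral, with [u] fixed modulo [pi]. *)
Lemma homothety_inv_power_ge k n : cong1 k ->
  mx_ge v 1 (pi ^+ n *: (GLmx ((k * homothety) ^- n)%g *m u) - u).
Proof.
move=> kc; rewrite -expVgn; set y := ((k * homothety)^-1)%g.
elim: n => [|n IHn].
  by rewrite expg0 expr0 scale1r mul1mx subrr; apply: mx_ge0.
have y_int : mx_ge v 0 (pi *: GLmx y).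
  rewrite /y invgM GLmxM scalemxAl; apply: (mx_geM vP (m := 0) (n := 0)).
    rewrite homothetyVE scalerDr scalerA mulfV ?uniformizer_neq0 // scale1r.
    apply: mx_geD => //; last exact: P_int.
    apply: (mx_ge_le (n := 1 + 0)) => //; apply: mx_geZ => //.
      exact: uniformizer_ge.
    exact: R_int.
  exact: cong1_int (cong1V kc).
have -> : pi ^+ n.+1 *: (GLmx (y ^+ n.+1)%g *m u) - u =
   (pi *: GLmx y) *m (pi ^+ n *: (GLmx (y ^+ n)%g *m u) - u)
   + (pi *: GLmx homothety^-1%g) *m ((GLmx k^-1%g - 1%:M) *m u).
  have gVu : (pi *: GLmx homothety^-1%g) *m u = u.
    rewrite homothetyVE -scalemxAl mulmxDl mulRu add0r -scalemxAl scalerA.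
    by rewrite mulfV ?uniformizer_neq0 // scale1r -mulmxA phi_u mulmx1.
  have gVk : (pi *: GLmx homothety^-1%g) *m GLmx k^-1%g = pi *: GLmx y.
    by rewrite -scalemxAl -GLmxM -invgM.
  rewrite (mulmxBl (GLmx k^-1%g)) mul1mx !mulmxBr (mulmxA _ (GLmx k^-1%g)) gVk gVu.
  rewrite addrA subrK -scalemxAr -scalemxAl scalerA mulmxA.
  by rewrite exprSr expgS GLmxM.
apply: mx_geD => //; first exact: (mx_geM vP (m := 0) (n := 1)).
apply: (mx_geM vP (m := 0) (n := 1)); last first.
  apply: (mx_geM vP (m := 1) (n := 0)) => //; by case: kc.
rewrite homothetyVE scalerDr scalerA mulfV ?uniformizer_neq0 // scale1r.
apply: mx_geD => //; last exact: P_int.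
apply: (mx_ge_le (n := 1 + 0)) => //; apply: mx_geZ => //; first exact: uniformizer_ge.
exact: R_int.
Qed.

(* The powers of k * homothety stay nonzero modulo pi on the kernel of phi, while
   those of its inverse grow on the line of u: no scaling bounds both. *)
Lemma homothety_powers_unbounded k (N : int) : (1 < r)%N -> cong1 k ->
  exists n, forall (c : K) (h : GL r K), c != 0 ->
    GLmx h = c *: GLmx ((k * homothety) ^+ n)%g ->
    mx_ge v N h -> mx_ge v N (GLmx h^-1%g) -> False.
Proof.
(* The two estimates below are [N <= v c] and [N <= - v c - n]; they add up to [n <= - 2 N], which
   this [n] violates. *)
move=> r1 kc; exists (`|N| + `|N| + 1)%N; set n := (_ + 1)%N.
set y := ((k * homothety) ^+ n)%g => c h c0 hE hN hVN.
have hVE : GLmx h^-1%g = c^-1 *: GLmx y^-1%g.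
  symmetry; apply: GLimx_unique; rewrite hE -scalemxAl -scalemxAr scalerA.
  by rewrite mulfV // scale1r -GLmxM mulgV.
(* If [R] vanished, the identity would be a column times a row, of rank at most 1, against
   [1 < r]. *)
have R0 : R != 0.
  apply: contraTneq r1 => /eqP; rewrite subr_eq0 -leqNgt => /eqP P1.
  by have := mulmx_max_rank u phi; rewrite -P1 mxrank1.
have [l [m [Rlm0 vRlm]]] := idempotent_unit_entry mulRR R_int R0.
have Rlm : ~ val_ge v 1 (R l m) by move/(val_geE Rlm0); rewrite vRlm.
(* [y R] is congruent to [R], so at a unit entry of [R] the bound on [c *: y R] bounds [c]. *)
have vc : N <= v c.
  have := homothety_power_ge n kc; rewrite -/y => hy.
  have yR0 : (GLmx y *m R) l m != 0.
    apply/eqP => e; apply: Rlm; rewrite -[R l m]opprK; apply: val_geN => //.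
    by have := hy l m; rewrite mxE e add0r mxE.
  have yRv : v ((GLmx y *m R) l m) <= 0.
    rewrite leNgt; apply/negP => gt0; apply: Rlm.
    have -> : R l m = (GLmx y *m R) l m - (GLmx y *m R - R) l m.
      by move: (GLmx y *m R) R => A B; rewrite !mxE; ring.
    by apply: val_geB => //; right; lia.
  have := mx_geM vP hN R_int; rewrite hE -scalemxAl addr0 => /(_ l m).
  rewrite mxE => /val_geE; rewrite mulf_neq0 // => /(_ isT).
  by rewrite valM // => vcy; apply: le_trans vcy _; rewrite gerDl.
(* The product of [pi ^+ n] and [phi y^-1 u] is congruent to 1, so [phi y^-1 u] has valuation
   exactly [- n]. *)
have vcV : N <= - v c - n%:Z.
  have := homothety_inv_power_ge n kc; rewrite -/y => hy.
  have := mx_geM vP phi_int hy.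
  rewrite mulmxBr phi_u -scalemxAr add0r; set a := phi *m (_ *m u) => ha.
  have vpa : v (pi ^+ n * a 0 0) = 0 /\ a 0 0 != 0.
    have := ha 0 0; rewrite !mxE /=; set z := pi ^+ n * _ => hz.
    have z1 : val_ge v 0 z.
      rewrite -[z](subrK 1); refine (val_geD vP _ (val_ge1 vP)).
      exact: val_ge_le hz.
    have nz1 : ~ val_ge v 1 z.
      move=> z1'; have := val_geB vP z1' hz; rewrite opprB addrC subrK.
      by move/(val_geE (oner_neq0 _)); rewrite val1.
    have z0 : z != 0 by apply/eqP => e; apply: nz1; left.
    split; last by apply: contraNneq z0; rewrite /z => ->; rewrite mulr0.
    have := val_geE z0 z1; rewrite le_eqVlt => /orP[/eqP ->//|?].
    by case: nz1; right; lia.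
  have [va a0] := vpa.
  have := mx_geM vP phi_int (mx_geM vP hVN u_int).
  rewrite hVE -scalemxAl -scalemxAr -/a add0r addr0 => /(_ 0 0); rewrite mxE.
  move/val_geE; rewrite mulf_neq0 ?invr_eq0 // => /(_ isT).
  move: va; rewrite !valM ?invr_eq0 ?expf_neq0 ?uniformizer_neq0 //.
  rewrite valX ?uniformizer_neq0 // v_pi valV //;  rewrite natz.
  by move: (v (a 0 0)) (v c) => x z; lia.
rewrite /n in vcV; lia.
Qed.

End Homothety.
End Congruence.

(** * Representatives of the cosets in the congruence subgroup *)

Section CosetRepresentatives.
Context {K : fieldType} {v : K -> int} (vP : valuation v) {r : nat}.
Variables (pi : K) (v_pi : v pi = 1) (u : 'cV[K]_r) (phi : 'rV[K]_r) (j : 'I_r).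
Hypotheses (u_int : mx_ge v 0 u) (phi_int : mx_ge v 0 phi) (phi_u : phi *m u = 1%:M).
Hypothesis phi_j : phi 0 j = 1.
Variables (q : nat) (rho : 'I_q -> K).
Hypotheses (rho_int : forall a, val_ge v 0 (rho a))
  (rho_inj : forall a a', val_ge v 1 (rho a - rho a') -> a = a')
  (rho_surj : forall x, val_ge v 0 x -> exists a, val_ge v 1 (x - rho a)).

Local Notation T := {ffun {l : 'I_r | l != j} -> 'I_q}.
Local Notation R := (1%:M - u *m phi).

(* The element of the kernel of phi with the prescribed coordinates off j. *)
Definition ker_vec (f : 'I_r -> K) : 'cV[K]_r :=
  \col_l (if l == j then - \sum_(m | m != j) phi 0 m * f m else f l).

Lemma phi_mulE (x : 'cV[K]_r) : (phi *m x) 0 0 = x j 0 + \sum_(m | m != j) phi 0 m * x m 0.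
Proof. by rewrite mxE (bigD1 j) //= phi_j mul1r. Qed.

Lemma ker_vecP f : phi *m ker_vec f = 0.
Proof.
apply/matrixP => a b; rewrite !ord1 phi_mulE [RHS]mxE [ker_vec f j 0]mxE eqxx.
apply/eqP; rewrite addrC subr_eq0; apply/eqP/eq_bigr => m mj.
by rewrite mxE (negPf mj).
Qed.

(** As [phi] is integral with entry 1 at [j], the coordinate at [j] of a vector of its kernel is an
    integral combination of the others: r - 1 coordinates control the vector. *)
Lemma ker_ge n (x : 'cV[K]_r) : phi *m x = 0 ->
  (forall l, l != j -> val_ge v n (x l 0)) -> mx_ge v n x.
Proof.
move=> x0 h l i; rewrite ord1; have [->|lj] := eqVneq l j; last exact: h.
have /eqP := phi_mulE x; rewrite x0 mxE eq_sym addr_eq0 => /eqP ->.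
apply: val_geN => //; apply: val_ge_sum => // m mj; rewrite -[n]add0r.
by apply: val_geM => //; apply: h.
Qed.

(** The value 0 at [j] is a default that [ker_vec] never reads. *)
Definition lift_coords (t : T) (l : 'I_r) : K :=
  if insub l is Some l' then rho (t l') else 0.

Lemma lift_coordsE (t : T) l (lj : l != j) : lift_coords t l = rho (t (Sub l lj)).
Proof. by rewrite /lift_coords insubT. Qed.

Definition coset_vec (t : T) := ker_vec (lift_coords t).

Lemma coset_vec_int t : mx_ge v 0 (coset_vec t).
Proof.
apply: ker_ge => [|l lj]; first exact: ker_vecP.
by rewrite mxE (negPf lj) lift_coordsE.
Qed.

Lemma coset_rep_subproof (t : T) (a b : K) : a + b = 0 ->
  a *: (coset_vec t *m phi) + b *: (coset_vec t *m phi) +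
  (a *: (coset_vec t *m phi)) *m (b *: (coset_vec t *m phi)) = 0.
Proof.
move=> ab; rewrite -scalerDl ab scale0r add0r -scalemxAl -scalemxAr mulmxA.
by rewrite -(mulmxA (coset_vec t)) ker_vecP mulmx0 mul0mx !scaler0.
Qed.

(** A transvection: with [w = coset_vec t] in the kernel of [phi], the matrix [w phi] has square
    zero, so [1 + pi w phi] has inverse [1 - pi w phi], and its invariant [R (k - 1) u] is
    [pi w]. *)
Definition coset_rep (t : T) : GL r K :=
  GL1D (coset_rep_subproof t (subrr pi)) (coset_rep_subproof t (addNr pi)).

Lemma coset_rep_cong1 t : cong1 (v := v) (coset_rep t).
Proof.
have h a : val_ge v 1 a -> mx_ge v 1 (1%:M + a *: (coset_vec t *m phi) - 1%:M).
  move=> ha; rewrite addrC addKr.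
  apply: (mx_geZ vP (m := 1) (n := 0)) => //.
  by apply: (mx_geM vP (m := 0) (n := 0)) => //; exact: coset_vec_int.
have := uniformizer_ge v_pi.
by split; apply: h => //; apply: val_geN.
Qed.

Lemma coset_repE t : R *m (GLmx (coset_rep t) - 1%:M) *m u = pi *: coset_vec t.
Proof.
rewrite /= [1%:M + _ - _]addrC addKr -scalemxAr -scalemxAl -!mulmxA phi_u mulmx1.
by rewrite mulmxBl mul1mx -mulmxA ker_vecP mulmx0 subr0.
Qed.

Lemma coset_rep_inj s t :
  cong1 (v := v) (homothety vP v_pi phi_u * ((coset_rep s)^-1 * coset_rep t) *
         (homothety vP v_pi phi_u)^-1)%g -> s = t.
Proof.
move/(conj_homothety_coset vP v_pi u_int phi_int phi_u
        (coset_rep_cong1 s) (coset_rep_cong1 t)).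
rewrite !coset_repE -scalerBr => h; apply/ffunP => -[l lj].
apply: esym; apply: rho_inj; have := h l 0; rewrite !mxE (negPf lj) => hl.
have := val_geM vP (uniformizerV_ge vP v_pi) hl.
rewrite mulKf ?(uniformizer_neq0 vP v_pi) // !lift_coordsE.
by rewrite (_ : exist _ _ _ = Sub l lj).
Qed.

Lemma coset_rep_surj k : cong1 (v := v) k -> exists t,
  cong1 (v := v) (homothety vP v_pi phi_u * ((coset_rep t)^-1 * k) *
         (homothety vP v_pi phi_u)^-1)%g.
Proof.
(* [z] is the coset invariant of [k] divided by [pi]; it lies in the kernel of [phi], so residue
   representatives of its coordinates off [j] determine it modulo [pi]. *)
move=> kc; set z := pi^-1 *: (R *m (GLmx k - 1%:M) *m u).
have z_int : mx_ge v 0 z.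
  apply: (mx_geZ vP (m := -1) (n := 1)); first exact: uniformizerV_ge.
  apply: (mx_geM vP (m := 1) (n := 0)) => //.
  apply: (mx_geM vP (m := 0) (n := 1)); first exact: R_int.
  by case: kc.
have phi_z : phi *m z = 0.
  by rewrite /z -scalemxAr 2!mulmxA mulphiR // !mul0mx scaler0.
have [t ht] : exists t : T, forall l, val_ge v 1 (z (val l) 0 - rho (t l)).
  have [f hf] := choice (fun l : {l : 'I_r | l != j} => rho_surj (z_int (val l) 0)).
  by exists (finfun f) => l; rewrite ffunE.
exists t.
apply/(conj_homothety_coset vP v_pi u_int phi_int phi_u (coset_rep_cong1 t) kc).
rewrite coset_repE (_ : _ *m u = pi *: z); last first.
  by rewrite scalerA mulfV ?(uniformizer_neq0 vP v_pi) // scale1r.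
rewrite -scalerBr; apply: (mx_geZ vP (m := 1) (n := 1)); first exact: uniformizer_ge.
apply: ker_ge => [|l lj]; first by rewrite mulmxBr phi_z ker_vecP subrr.
have := ht (Sub l lj); rewrite SubK => h.
have tE : coset_vec t l 0 = rho (t (Sub l lj)) by rewrite mxE (negPf lj) lift_coordsE.
have subE (x y : 'cV[K]_r) : (x - y) l 0 = x l 0 - y l 0 by rewrite !mxE.
by rewrite subE tE.
Qed.

End CosetRepresentatives.

(** * Residue classes, lattice bases and unboundedness at one place *)

Section ResidueField.
Context {F : fieldType} {v : place F} (Fv : completion v).
Local Notation vv := (@cval _ _ _ Fv).

Lemma uniformizer_ex : exists pi : Fv, vv pi = 1.
Proof. by have [x vx] := place_normalized v; exists (cemb Fv x); rewrite cval_emb. Qed.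

Lemma residue_class_eq (x y : Fv) :
  [set z | maxideal (z - x)] = [set z | maxideal (z - y)] <-> maxideal (x - y).
Proof.
have vP := cvalP Fv; split=> [e|xy].
  have : [set z | maxideal (z - x)] x by rewrite /= subrr; left.
  by rewrite e.
apply/seteqP; split=> z /= hz.
  by rewrite -[z](subrK x) -addrA; apply: val_geD.
by rewrite -[z](subrK y) -addrA -[y - x]opprB; apply: val_geB.
Qed.

(** [residue_card] goes through [fset_set], which has a default value on infinite sets; finiteness
    is therefore assumed here and obtained later from compactness. *)
Lemma residue_reps : finite_set (@residue_field _ _ Fv) ->
  exists rho : 'I_(residue_card Fv) -> Fv,
    [/\ forall a, val_ge vv 0 (rho a),
        forall a a', val_ge vv 1 (rho a - rho a') -> a = a'
      & forall x, val_ge vv 0 x -> exists a, val_ge vv 1 (x - rho a)].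
Proof.
move=> fin; have vP := cvalP Fv; set s := enum_fset (fset_set (@residue_field _ _ Fv)).
have memE c : (c \in s) = (c \in @residue_field _ _ Fv).
  exact: (in_fset_set fin).
have nthP (a : 'I_(residue_card Fv)) :
    exists x, val_ge vv 0 x /\ [set z | maxideal (z - x)] = nth set0 s a.
  have : nth set0 s a \in s by rewrite mem_nth.
  by rewrite memE inE => -[x xint <-]; exists x.
have [rho rhoP] := choice nthP; exists rho; split.
- by move=> a; case: (rhoP a).
- move=> a a' /residue_class_eq; rewrite (proj2 (rhoP a)) (proj2 (rhoP a')) => /eqP.
  by rewrite nth_uniq ?fset_uniq // => /eqP/val_inj.
- move=> x xint; pose c : set Fv := [set z | maxideal (z - x)].
  have cs : c \in s by rewrite memE inE; exists x.
  have lt : (index c s < residue_card Fv)%N by rewrite index_mem.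
  by exists (Ordinal lt); apply/residue_class_eq; rewrite (proj2 (rhoP _)) /= nth_index.
Qed.

End ResidueField.

Section Lattice.
Context {F : fieldType} {oo : place F} {Fh : completions F}.
Context {p : primes_off [set oo]} {r : nat}.
Local Notation Fv := (Fh (val p)).
Local Notation vv := (@cval _ _ _ Fv).
Implicit Types (Lambda : set 'cV[Fv]_r) (k : GL r Fv).

(** A power of [pi] makes any linear relation between the columns of [B] integral, so independence
    over the valuation ring is independence over the field. *)
Lemma free_lattice_GL Lambda : free_lattice Lambda ->
  exists B : GL r Fv, Lambda = [set B *m a | a in [set a : 'cV_r | mx_ge vv 0 a]].
Proof.
case=> B [B_inj ->]; have vP := cvalP Fv; have [pi v_pi] := uniformizer_ex Fv.
have Bu : B \in unitmx.
  rewrite -unitmx_tr -row_free_unit; apply: inj_row_free => x xB.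
  have [n xn] := mx_ge_bound (v := vv) x.
  have : pi ^+ `|n|%N *: x^T = 0.
    apply: B_inj.
      apply: (mx_ge_le (n := `|n|%N%:Z + n)); first by lia.
      apply: mx_geZ => //; first exact: uniformizer_exp_ge.
      by move=> i j; rewrite mxE.
    by rewrite -scalemxAr -[B]trmxK -trmx_mul xB trmx0 scaler0.
  move/eqP; rewrite scaler_eq0 expf_eq0 (negPf (uniformizer_neq0 vP v_pi)) andbF /=.
  by move/eqP => x0; rewrite -[x]trmxK x0 trmx0.
by exists (MkGL (mulmxV Bu) (mulVmx Bu)).
Qed.

(** Testing on the basis vectors [B e_j] reads off the columns of the conjugate. The equality of
    [k Lambda] with [Lambda], not a mere inclusion, gives the integrality of the inverse. *)
Lemma congruence_subgroupP (B : GL r Fv) k :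
  congruence_subgroup [set B *m a | a in [set a : 'cV_r | mx_ge vv 0 a]] k <->
  cong1 (v := vv) (B^-1 * k * B)%g.
Proof.
have vP := cvalP Fv; have [pi v_pi] := uniformizer_ex Fv; set Lambda := [set _ | _ in _].
have LambdaP (x : 'cV_r) : Lambda x <-> mx_ge vv 0 (GLmx B^-1%g *m x).
  split=> [[a aint <-]|h]; first by rewrite mulmxA -GLmxM mulVg mul1mx.
  exists (GLmx B^-1%g *m x) => //.
  by rewrite mulmxA -GLmxM mulgV mul1mx.
have stable_int (l : GL r Fv) : (forall x, Lambda x -> Lambda (l *m x)) ->
    mx_ge vv 0 (GLmx (B^-1 * l * B)%g).
  move=> h i j; have : Lambda (l *m (B *m delta_mx j 0)).
    by apply: h; exists (delta_mx j 0) => //; apply: mx_ge_delta.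
  move/LambdaP => /(_ i 0); rewrite !mulmxA -!GLmxM -colE mxE; exact.
split=> [[kL kcong]|kc].
  have k_int : mx_ge vv 0 (GLmx (B^-1 * k * B)^-1%g).
    have -> : ((B^-1 * k * B)^-1 = B^-1 * k^-1 * B)%g by rewrite !invgM invgK mulgA.
    apply: stable_int => x; rewrite -{1}kL => -[y yL <-].
    by rewrite mulmxA -GLmxM mulVg mul1mx.
  have k1 : mx_ge vv 1 (GLmx (B^-1 * k * B)%g - 1%:M).
    move=> i j; have : Lambda (B *m delta_mx j 0).
      by exists (delta_mx j 0) => //; apply: mx_ge_delta.
    case/kcong => a [y [a1 /LambdaP yL e]].
    have -> : GLmx (B^-1 * k * B)%g - 1%:M =
        GLmx B^-1%g *m (GLmx k *m GLmx B - GLmx B).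
      by rewrite mulmxBr mulmxA -!GLmxM mulVg.
    have := congr1 (fun z => (GLmx B^-1%g *m z) i 0) e.
    rewrite mulmxA -mulmxBl mulmxA -colE mxE => ->.
    by rewrite -scalemxAr mxE; apply: (val_geM vP (m := 1) (n := 0)).
  split=> //; rewrite (_ : GLmx _ - _ =
    - (GLmx (B^-1 * k * B)^-1%g *m (GLmx (B^-1 * k * B)%g - 1%:M))).
    by apply: mx_geN => //; apply: (mx_geM vP (m := 0) (n := 1)).
  by rewrite mulmxBr mulmx1 -GLmxM mulVg opprB.
have conj_stable (l : GL r Fv) x : cong1 (v := vv) (B^-1 * l * B)%g ->
    Lambda x -> Lambda (l *m x).
  move=> lc [a aint <-]; apply/LambdaP; rewrite !mulmxA -!GLmxM.
  by apply: (mx_geM vP (m := 0) (n := 0)) => //; apply: cong1_int.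
split.
  apply/seteqP; split=> [_ [x xL <-]|x xL]; first exact: conj_stable.
  exists (GLmx k^-1%g *m x); last by rewrite mulmxA -GLmxM mulgV mul1mx.
  apply: conj_stable => //.
  have -> : (B^-1 * k^-1 * B = (B^-1 * k * B)^-1)%g by rewrite !invgM invgK mulgA.
  exact: cong1V.
move=> _ [a aint <-]; exists pi, (pi^-1 *: (GLmx k *m (GLmx B *m a) - GLmx B *m a)); split.
- exact: uniformizer_ge.
- apply/LambdaP; rewrite -scalemxAr.
  apply: (mx_geZ vP (m := -1) (n := 1)); first exact: uniformizerV_ge.
  have -> : GLmx B^-1%g *m (GLmx k *m (GLmx B *m a) - GLmx B *m a) =
      (GLmx (B^-1 * k * B)%g - 1%:M) *m a.
    by rewrite mulmxBr mulmxBl !mulmxA -!GLmxM mulVg.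
  by apply: (mx_geM vP (m := 1) (n := 0)) => //; case: kc.
- by rewrite scalerA mulfV ?(uniformizer_neq0 vP v_pi) // scale1r.
Qed.

End Lattice.

Section Unbounded.
Context {F : fieldType} {v : place F} {Fv : completion v} {r : nat}.
Local Notation vv := (@cval _ _ _ Fv).
Variables (pi : Fv) (v_pi : vv pi = 1) (u : 'cV[Fv]_r) (phi : 'rV[Fv]_r).
Hypotheses (u_int : mx_ge vv 0 u) (phi_int : mx_ge vv 0 phi) (phi_u : phi *m u = 1%:M).
Local Notation g0 := (homothety (cvalP Fv) v_pi phi_u).

Lemma toPGLX (g : GL r Fv) n : toPGL (g ^+ n)%g = (toPGL g ^+ n)%g.
Proof. by elim: n => [//|n IHn]; rewrite !expgS toPGLM IHn. Qed.

Lemma conjVgX (x y : GL r Fv) n : (x^-1 * y ^+ n * x)%g = ((x^-1 * y * x) ^+ n)%g.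
Proof.
elim: n => [|n IHn]; first by rewrite !expg0 mulg1 mulVg.
by rewrite !expgS -IHn !mulgA mulgK.
Qed.

Lemma cyclic_unbounded (B k1 k2 : GL r Fv) : (1 < r)%N ->
  cong1 (v := vv) (B^-1 * k1 * B)%g -> cong1 (v := vv) (B^-1 * k2 * B)%g ->
  ~ PGL_bounded (cyclic_subgroup (toPGL (k1 * (B * g0 * B^-1) * k2)%g)).
Proof.
move=> r1 kc1 kc2 [S [N SN] sub]; pose vP := cvalP Fv.
(* Conjugating by [D] moves [k2] to the front, leaving a single congruence factor [k] before [g0];
   as [D] is fixed, bounds change only by the constants [a] and [d]. *)
set y := (k1 * _ * k2)%g in sub; pose D := (k2^-1 * B)%g.
pose k := (B^-1 * k2 * B * (B^-1 * k1 * B))%g.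
have kc : cong1 (v := vv) k by apply: cong1M.
have y1 : (D^-1 * y * D)%g = (k * g0)%g.
  by rewrite /D /y /k !invgM invgK !mulgA !mulgK mulgVK.
have yn n : (D^-1 * y ^+ n * D)%g = ((k * g0) ^+ n)%g by rewrite -y1 conjVgX.
have [a Da] := mx_ge_bound (v := vv) (GLmx D^-1%g).
have [d Dd] := mx_ge_bound (v := vv) (GLmx D).
have [n contra] := homothety_powers_unbounded (cvalP Fv) v_pi u_int phi_int phi_u (a + N + d) r1 kc.
have : cyclic_subgroup (toPGL y) (toPGL y ^+ n)%g by left; exists n.
case/sub => h Sh; rewrite -toPGLX => /esym/toPGL_eq [c c0 hE].
have bnd (l : GL r Fv) : mx_ge vv N l -> mx_ge vv (a + N + d) (GLmx (D^-1 * l * D)%g).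
  by move=> hl; rewrite !GLmxM; apply: mx_geM => //; apply: mx_geM.
apply: (contra c (D^-1 * h * D)%g c0).
- by rewrite -yn !GLmxM hE -scalemxAr -scalemxAl.
- by apply: bnd => i j; case: (SN h i j Sh).
- have -> : ((D^-1 * h * D)^-1 = D^-1 * h^-1 * D)%g by rewrite invgM (invgM D^-1%g) invgK mulgA.
  by apply: bnd => i j; case: (SN h i j Sh).
Qed.

End Unbounded.

(** * Restriction of places from F' to F *)

Section PlaceBelow.
Context {F : fieldType} {F' : fieldExtType F} (w : place F').
Let wP := place_valP w.

Lemma in_alg_neq0 (x : F) : x != 0 -> x%:A != 0 :> F'.
Proof. by rewrite scaler_eq0 oner_eq0 orbF. Qed.

(* Were w trivial on F, the leading term of the minimal polynomial of z, w z < 0,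
   would have smaller valuation than all others. *)
Lemma place_nontrivial : exists2 x : F, x != 0 & w x%:A != 0.
Proof.
apply: contrapT => triv.
have w0 (x : F) : x != 0 -> w x%:A = 0.
  by move=> x0; apply: contrapT => /eqP wx; apply: triv; exists x.
have [y wy] := place_normalized w.
have y0 : y != 0 by apply: contra_eq_neq wy => ->; case: wP => -> _ _.
set z := y^-1; have z0 : z != 0 by rewrite invr_eq0.
have wz : w z = - 1 by rewrite valV ?wy.
set Q := minPoly 1%AS z; have Qmon : Q \is monic := monic_minPoly _ _.
have sQ : size Q = (size Q).-1.+1 by rewrite prednK // lt0n size_poly_eq0 monic_neq0.
have /rootP := root_minPoly 1%AS z; rewrite -/Q horner_coef sQ big_ord_recr /=.
have -> : Q`_(size Q).-1 = 1 by exact/monicP.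
rewrite mul1r => /eqP; rewrite addrC addr_eq0 => /eqP zn.
have : val_ge w (1 - (size Q).-1%:Z) (z ^+ (size Q).-1).
  rewrite zn; apply: val_geN => //; apply: val_ge_sum => // i _.
  have /vlineP[a ->] : Q`_i \in 1%VS by apply/polyOverP/minPolyOver.
  have [->|a0] := eqVneq a 0; first by rewrite scale0r mul0r; left.
  right; rewrite valM ?in_alg_neq0 ?expf_neq0 // w0 // add0r valX // wz.
  by rewrite mulNrn natz; move: (ltn_ord i); move: (size Q).-1 (nat_of_ord i) => n k; lia.
move/(val_geE (expf_neq0 _ z0)); rewrite valX // wz mulNrn natz.
by move: (_.-1) => n; lia.
Qed.

(** The values of [w] on nonzero elements of F form a nonzero subgroup of the integers; dividing by
    its positive generator [e] normalizes the restriction. This serves to reach every component of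
    [b], whose linearity is stated along pairs w | v. *)
Lemma place_below : exists v : place F, lies_above w v.
Proof.
have wM := valM wP; pose S (n : int) := exists2 x : F, x != 0 & w x%:A = n.
have SN n : S n -> S (- n).
  case=> x x0 <-; exists x^-1; first by rewrite invr_eq0.
  by rewrite -[_%:A]/(in_alg F' _) fmorphV valV // in_alg_neq0.
have SD m n : S m -> S n -> S (m + n).
  case=> x x0 <- [y y0 <-]; exists (x * y); first by rewrite mulf_neq0.
  by rewrite -[_%:A]/(in_alg F' _) rmorphM wM ?in_alg_neq0.
have [e0 [e0_gt0 Se0]] : exists e : nat, (0 < e)%N /\ S e%:Z.
  have [x x0 wx] := place_nontrivial; exists `|w x%:A|%N; split; first by lia.
  have Sx : S (w x%:A) by exists x.
  have [?|?] := leP 0 (w x%:A); first by rewrite (_ : _%:Z = w x%:A) //; lia.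
  by rewrite (_ : _%:Z = - w x%:A); [exact: SN | lia].
have ex : exists e : nat, (0 < e)%N && `[< S e%:Z >].
  by exists e0; rewrite e0_gt0; apply/asboolP.
case: (ex_minnP ex) => e /andP[e_gt0 /asboolP Se] e_min.
have e_neq0 : e%:Z != 0 by lia.
have SMn (k : nat) : S (e%:Z *+ k).
  elim: k => [|k IHk]; last by rewrite mulrS; apply: SD.
  by rewrite mulr0n -(subrr e%:Z); apply/SD/SN.
have Sdvd n : S n -> n = (n %/ e%:Z)%Z * e%:Z.
  move=> Sn; have Sq : S (- ((n %/ e%:Z)%Z * e%:Z)).
    case: (n %/ e%:Z)%Z => k.
      by apply: SN; have := SMn k; rewrite -mulr_natl natz.
    by have := SMn k.+1; rewrite NegzE mulNr opprK -mulr_natl natz.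
  have := SD _ _ Sn Sq; rewrite {1 3}(divz_eq n e%:Z) [_ + (n %% _)%Z]addrC addrK.
  have := modz_ge0 n e_neq0; have := ltz_pmod n (d := e%:Z) e_gt0.
  case: (n %% e%:Z)%Z => m lt_me ge0m Sm; last by [].
  case: m => [|m] in lt_me ge0m Sm *; first by rewrite add0r.
  have := e_min m.+1; rewrite /= asboolT // => /(_ isT); lia.
pose v (x : F) : int := (w x%:A %/ e%:Z)%Z.
have vE x : w x%:A = v x * e%:Z.
  have [->|x0] := eqVneq x 0; last by apply: Sdvd; exists x.
  by rewrite /v scale0r; case: wP => -> _ _; rewrite div0z mul0r.
have vge n x : val_ge v n x <-> val_ge w (n * e%:Z) x%:A.
  have [->|x0] := eqVneq x 0; first by rewrite scale0r; split; left.
  split=> [/(val_geE x0)|/(val_geE (in_alg_neq0 x0))] h; right.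
    by rewrite vE ler_pM2r //; lia.
  by move: h; rewrite vE ler_pM2r //; lia.
have vP : valuation v.
  split.
  - by rewrite /v scale0r; case: wP => -> _ _; rewrite div0z.
  - move=> x y x0 y0; apply: (mulIf e_neq0); rewrite mulrDl -!vE.
    by rewrite -[(x * y)%:A]/(in_alg F' _) rmorphM wM ?in_alg_neq0.
  - move=> n x y /vge hx /vge hy; apply/vge; rewrite scalerDl.
    exact: val_geD.
have vn : exists x, v x = 1.
  by have [x _ wx] := Se; exists x; apply: (mulIf e_neq0); rewrite -vE wx mul1r.
exists (Place vP vn), e; split=> // x /=.
by rewrite vE -mulr_natr natz.
Qed.

End PlaceBelow.

Lemma cV_sum_delta (K : fieldType) n (x : 'cV[K]_n) : x = \sum_i x i 0 *: delta_mx i 0.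
Proof. by rewrite {1}[x]matrix_sum_delta; apply: eq_bigr => i _; rewrite big_ord1. Qed.

Lemma mulmx_ext (K : fieldType) m n (M N : 'M[K]_(m, n)) :
  (forall x : 'cV_n, M *m x = N *m x) -> M = N.
Proof.
move=> h; apply/matrixP => i j.
by have := h (delta_mx j 0); rewrite -!colE => /matrixP/(_ i 0); rewrite !mxE.
Qed.

(** * Adeles supported at one place *)

Section SingleAdele.
Context {F : fieldType} {Fh : completions F} {S : set (place F)}.
Local Notation A := (adele Fh S).
Implicit Types (p v : primes_off S).

Lemma single_at p (x : Fh (val p)) : (single x : A) p = x.
Proof.
rewrite /= /single_fun; case: pselect => // e.
by rewrite (Prop_irrelevance e erefl).
Qed.

Lemma single_at_neq p v (x : Fh (val p)) : v <> p -> (single x : A) v = 0.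
Proof. by move=> vp; rewrite /= /single_fun; case: pselect => // e; case: vp. Qed.

Lemma at_mxZ v m n (a : A) (M : 'M[A]_(m, n)) :
  map_mx (at_place v) (a *: M) = a v *: map_mx (at_place v) M.
Proof. by apply/matrixP => i j; rewrite !mxE. Qed.

Lemma mx_adeleP m n (M N : 'M[A]_(m, n)) :
  (forall v, map_mx (at_place v) M = map_mx (at_place v) N) -> M = N.
Proof.
move=> h; apply/matrixP => i j; apply: adeleP => v.
by have /matrixP/(_ i j) := h v; rewrite !mxE.
Qed.

Definition single_mx p m n (M : 'M[Fh (val p)]_(m, n)) : 'M[A]_(m, n) :=
  map_mx (@single _ Fh S p) M.

Lemma at_single_mx p m n (M : 'M[Fh (val p)]_(m, n)) :
  map_mx (at_place p) (single_mx M) = M.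
Proof. by apply/matrixP => i j; rewrite !mxE; apply: single_at. Qed.

Lemma at_single_mx_neq p v m n (M : 'M[Fh (val p)]_(m, n)) : v <> p ->
  map_mx (at_place v) (single_mx M) = 0.
Proof. by move=> vp; apply/matrixP => i j; rewrite !mxE; apply: single_at_neq. Qed.

(** Cutting down to the component at [p] is multiplication by an idempotent adele, hence compatible
    with the linearity of [b]. *)
Lemma single_mx_at p m n (M : 'M[A]_(m, n)) :
  single_mx (map_mx (at_place p) M) = @single _ Fh S p 1 *: M.
Proof.
apply/mx_adeleP => v; rewrite at_mxZ; have [->|vp] := pselect (v = p).
  by rewrite at_single_mx single_at scale1r.
by rewrite at_single_mx_neq // single_at_neq // scale0r.
Qed.

Lemma single_mxD p m n (M N : 'M[Fh (val p)]_(m, n)) :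
  single_mx (M + N) = single_mx M + single_mx N.
Proof.
apply/mx_adeleP => v; rewrite map_mxD; have [->|vp] := pselect (v = p).
  by rewrite !at_single_mx.
by rewrite !at_single_mx_neq // addr0.
Qed.

Lemma single_mxZ p m n a (M : 'M[Fh (val p)]_(m, n)) :
  single_mx (a *: M) = single a *: single_mx M.
Proof.
apply/mx_adeleP => v; rewrite at_mxZ; have [->|vp] := pselect (v = p).
  by rewrite !at_single_mx single_at.
by rewrite !at_single_mx_neq // scaler0.
Qed.

Lemma single_mx_inj p m n : injective (@single_mx p m n).
Proof. by move=> M N e; rewrite -[M]at_single_mx e at_single_mx. Qed.

Section GLSingle.
Context {r : nat} {p : primes_off S}.

Lemma GL_single_subproof (M N : 'M[Fh (val p)]_r) : M *m N = 1%:M ->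
  (1%:M + single_mx (M - 1%:M)) *m (1%:M + single_mx (N - 1%:M)) = 1%:M.
Proof.
move=> MN; apply/mx_adeleP => v; rewrite map_mxM !map_mxD !map_mx1.
have [->|vp] := pselect (v = p); last by rewrite !at_single_mx_neq // addr0 mulmx1.
by rewrite !at_single_mx !(addrC 1%:M) !subrK.
Qed.

(** [single_mx] is 0 away from [p], so the identity there is obtained by perturbing 1 by [g - 1]. *)
Definition GL_single (g : GL r (Fh (val p))) : GL r A :=
  MkGL (GL_single_subproof (GLmxV g)) (GL_single_subproof (GLVmx g)).

Lemma GL_at_single g : GL_at p (GL_single g) = g.
Proof.
by apply: GL_inj; rewrite /= map_mxD map_mx1 at_single_mx addrC subrK.
Qed.

Lemma GL_at_single_neq v g : v <> p -> GL_at v (GL_single g) = 1%g.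
Proof.
by move=> vp; apply: GL_inj; rewrite /= map_mxD map_mx1 at_single_mx_neq // addr0.
Qed.

Lemma GL_single_mul g (x : 'cV[A]_r) :
  GL_single g *m x = x + single_mx ((GLmx g - 1%:M) *m vec_at p x).
Proof.
apply/mx_adeleP => v; rewrite map_mxM -/(vec_at v x).
have -> : map_mx (at_place v) (GL_single g) = GL_at v (GL_single g) by [].
rewrite map_mxD; have [->|vp] := pselect (v = p).
  by rewrite at_single_mx GL_at_single mulmxBl mul1mx addrC subrK.
by rewrite at_single_mx_neq // GL_at_single_neq // addr0 mul1mx.
Qed.

End GLSingle.
End SingleAdele.
Arguments single_mx {F Fh S p m n} M.

(** * Transport of local endomorphisms through [b] *)

Section Transfer.
Context {F : fieldType} {F' : fieldExtType F} {oo : place F} {oo' : place F'}.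
Context {Fh : completions F} {Fh' : completions F'} {r r' : nat}.
Context (oo'_unique : forall w : place F', lies_above w oo -> w = oo').
Context (b : @adelic_iso F F' oo oo' Fh Fh' r r').
Local Notation A := (adele Fh [set oo]).
Local Notation A' := (adele Fh' [set oo']).

(** Since [oo'] is the only place above [oo], a prime of F' cannot restrict to [oo]. *)
Lemma prime_below (w : primes_off [set oo']) :
  exists v : primes_off [set oo], lies_above (val w) (val v).
Proof.
have [v wv] := place_below (val w).
have v_oo : v \notin [set oo].
  apply/negP; rewrite inE => /= voo; rewrite voo in wv.
  by have := valP w; rewrite (oo'_unique wv) => /negP; apply; rewrite inE.
by exists (exist _ v v_oo).
Qed.

Lemma biso0 : b 0 = 0.
Proof. by apply: (addIr (b 0)); rewrite -bisoD !add0r. Qed.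

(** Comparing a scalar with the adeles 0 and 1 in this way avoids algebraic properties of
    [local_emb], whose values are picked by [xget]. *)
Lemma biso_local (v : primes_off [set oo]) (w : primes_off [set oo']) (a a' : A) x :
  lies_above (val w) (val v) -> a v = a' v ->
  vec_at w (b (a *: x)) = vec_at w (b (a' *: x)).
Proof. by move=> wv e; rewrite !(bisoZ _ _ _ wv) e. Qed.

Context {p : primes_off [set oo]}.
Local Notation Fp := (Fh (val p)).

(** The place below [w] is some [v] other than [p]. The idempotent adele that fixes [single_mx x]
    vanishes at [v], so on the component at [w] it acts as 0 does. *)
Lemma b_single_off (x : 'cV[Fp]_r) (w : primes_off [set oo']) :
  ~ lies_above (val w) (val p) -> vec_at w (b (single_mx x)) = 0.
Proof.
move=> wp; have [v wv] := prime_below w.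
have vp : v <> p by move=> vp; apply: wp; rewrite -vp.
rewrite -[x]scale1r single_mxZ (@biso_local v w _ 0) //.
  by rewrite scale0r biso0; apply: map_mx0.
exact: single_at_neq.
Qed.

Lemma b_single_at (x : 'cV[A]_r) (w : primes_off [set oo']) :
  lies_above (val w) (val p) ->
  vec_at w (b (single_mx (vec_at p x))) = vec_at w (b x).
Proof.
move=> wp; rewrite single_mx_at (@biso_local p w _ 1) ?scale1r //.
exact: single_at.
Qed.

Lemma b_single_inj (x y : 'cV[Fp]_r) :
  (forall w : above p, b_at b x w = b_at b y w) -> x = y.
Proof.
move=> h; apply: (single_mx_inj (S := [set oo])).
apply: (bij_inj (biso_bij b)); apply: mx_adeleP => w.
have [wp|wp] := pselect (lies_above (val w) (val p)); first exact: (h (exist _ w wp)).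
by rewrite -[LHS]/(vec_at w _) -[RHS]/(vec_at w _) !b_single_off.
Qed.

Context {p' : primes_off [set oo']} (p'_above : lies_above (val p') (val p)).
Context (p'_degree : local_degree_one Fh Fh' p p').
Context (binv : 'cV[A']_r' -> 'cV[A]_r) (binvK : cancel binv b).
Local Notation Fp' := (Fh' (val p')).
Local Notation sigma := (local_emb Fh Fh' (val p) (val p')).

Definition b_res (x : 'cV[Fp]_r) : 'cV[Fp']_r' := vec_at p' (b (single_mx x)).
Definition b_sec (y : 'cV[Fp']_r') : 'cV[Fp]_r := vec_at p (binv (single_mx y)).

(** Pulling back a vector supported at p' and keeping only its component at [p] loses nothing: above
    [p] that component decides, elsewhere both sides vanish. *)
Lemma b_single_sec y : b (single_mx (b_sec y)) = single_mx y.
Proof.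
apply: mx_adeleP => w; rewrite -/(vec_at w _).
have [wp|wp] := pselect (lies_above (val w) (val p)).
  by rewrite b_single_at // binvK.
by rewrite b_single_off // at_single_mx_neq // => wp'; apply: wp; rewrite wp'.
Qed.

Lemma b_secK : cancel b_sec b_res.
Proof. by move=> y; rewrite /b_res b_single_sec; apply: at_single_mx. Qed.

Lemma b_resD x y : b_res (x + y) = b_res x + b_res y.
Proof. by rewrite /b_res single_mxD bisoD; apply: map_mxD. Qed.

Lemma b_res0 : b_res 0 = 0.
Proof. by apply: (addIr (b_res 0)); rewrite -b_resD !add0r. Qed.

Lemma b_resZ a x : b_res (a *: x) = sigma a *: b_res x.
Proof. by rewrite /b_res single_mxZ (bisoZ _ _ _ p'_above) single_at. Qed.

Lemma b_secD x y : b_sec (x + y) = b_sec x + b_sec y.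
Proof.
apply: (single_mx_inj (S := [set oo])); apply: (bij_inj (biso_bij b)).
by rewrite single_mxD bisoD !b_single_sec single_mxD.
Qed.

Lemma b_sec0 : b_sec 0 = 0.
Proof. by apply: (addIr (b_sec 0)); rewrite -b_secD !add0r. Qed.

Lemma b_secZ a y : b_sec (sigma a *: y) = a *: b_sec y.
Proof.
apply: (single_mx_inj (S := [set oo])); apply: (bij_inj (biso_bij b)).
rewrite b_single_sec [in b _]single_mxZ; apply: mx_adeleP => w.
rewrite -[LHS]/(vec_at w _) -[RHS]/(vec_at w _).
have [wp|wp] := pselect (lies_above (val w) (val p)).
  rewrite (bisoZ _ _ _ wp) single_at b_single_sec.
  have [->|wp'] := pselect (w = p'); first by rewrite /vec_at !at_single_mx.
  by rewrite /vec_at !at_single_mx_neq // scaler0.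
rewrite -single_mxZ b_single_off // /vec_at at_single_mx_neq // => wp'.
by apply: wp; rewrite wp'.
Qed.

(** The idempotent E: seen through b_p, the projection of the product over w | p onto its factor at
    p'. *)
Definition b_proj : 'M[Fp]_r := \matrix_(i, j) b_sec (b_res (delta_mx j 0)) i 0.

Lemma b_projE x : b_proj *m x = b_sec (b_res x).
Proof.
rewrite [in RHS](cV_sum_delta x).
rewrite (big_morph b_res b_resD b_res0) (big_morph b_sec b_secD b_sec0).
apply/matrixP => i k; rewrite ord1 mxE summxE; apply: eq_bigr => j _.
by rewrite b_resZ b_secZ !mxE mulrC.
Qed.

Lemma b_proj_idem : b_proj *m b_proj = b_proj.
Proof.
by apply: mulmx_ext => x; rewrite -mulmxA !b_projE b_secK.
Qed.

(* The endomorphism of F'_p'^r' induced by M; since [F'_p' : F_p] = 1 it is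
   F'_p'-linear. *)
Definition b_transfer (M : 'M[Fp]_r) : 'M[Fp']_r' :=
  \matrix_(i, j) b_res (M *m b_sec (delta_mx j 0)) i 0.

Lemma b_transferE M y : b_transfer M *m y = b_res (M *m b_sec y).
Proof.
rewrite [in RHS](cV_sum_delta y) (big_morph b_sec b_secD b_sec0) mulmx_sumr.
rewrite (big_morph b_res b_resD b_res0).
apply/matrixP => i k; rewrite ord1 mxE summxE; apply: eq_bigr => j _.
have [a <-] := p'_degree (y j 0).
by rewrite b_secZ -scalemxAr b_resZ !mxE mulrC.
Qed.

(** Between two transfers stands [b_res] followed by [b_sec], that is [b_proj], which [M]
    absorbs. *)
Lemma b_transferM M N : M *m b_proj = M ->
  b_transfer M *m b_transfer N = b_transfer (M *m N).
Proof.
move=> ME; apply: mulmx_ext => x; rewrite -mulmxA !b_transferE.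
by rewrite -b_projE !mulmxA ME.
Qed.

Lemma b_transferD M N : b_transfer (M + N) = b_transfer M + b_transfer N.
Proof. by apply: mulmx_ext => y; rewrite mulmxDl !b_transferE mulmxDl b_resD. Qed.

Lemma b_transfer_subproof (M N : 'M[Fp]_r) : M *m N = 1%:M ->
  (M - 1%:M) *m b_proj = M - 1%:M ->
  (1%:M + b_transfer (M - 1%:M)) *m (1%:M + b_transfer (N - 1%:M)) = 1%:M.
Proof.
move=> MN ME; apply: GL1D_subproof; rewrite b_transferM // -!b_transferD.
rewrite mulmxBr mulmx1 mulmxBl MN mul1mx -[1%:M - N]opprB -opprD.
rewrite [X in _ - X]addrC subrr.
by apply: mulmx_ext => y; rewrite b_transferE !mul0mx b_res0.
Qed.

(** The second condition puts the image of [g - 1] in the summand, so [b] sends it to vectors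
    supported at p'; the first makes [g - 1] depend only on the p'-component of [b x]. *)
Lemma b_transfer_GL (g : GL r Fp) :
  (GLmx g - 1%:M) *m b_proj = GLmx g - 1%:M ->
  b_proj *m (GLmx g - 1%:M) = GLmx g - 1%:M ->
  exists g' : GL r' A', (forall w, w <> p' -> GL_at w g' = 1%g) /\
    forall x, b (GL_single g *m x) = g' *m b x.
Proof.
move=> gE Eg; have gVE : (GLmx g^-1%g - 1%:M) *m b_proj = GLmx g^-1%g - 1%:M.
  have -> : GLmx g^-1%g - 1%:M = - (GLmx g^-1%g *m (GLmx g - 1%:M)).
    by rewrite mulmxBr mulmx1 -GLmxM mulVg opprB.
  by rewrite mulNmx -mulmxA gE.
exists (GL_single (MkGL (b_transfer_subproof (GLmxV g) gE)
                        (b_transfer_subproof (GLVmx g) gVE))).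
split=> [w wp|x]; first exact: GL_at_single_neq.
rewrite !GL_single_mul bisoD; congr (_ + _).
rewrite [in RHS]/= [1%:M + _ - _]addrC addKr b_transferE.
rewrite -{1}Eg -mulmxA b_projE b_single_sec; congr single_mx; congr b_res.
by rewrite -[in RHS](b_single_at _ p'_above) -/(b_res _) -b_projE mulmxA gE.
Qed.

End Transfer.

Section ProjectionLattice.
Context {F : fieldType} {F' : fieldExtType F} {oo : place F} {oo' : place F'}.
Context {Fh : completions F} {Fh' : completions F'} {r r' : nat}.
Context (oo'_unique : forall w : place F', lies_above w oo -> w = oo').
Context (b : @adelic_iso F F' oo oo' Fh Fh' r r').
Context {p : primes_off [set oo]} {p' : primes_off [set oo']}.
Context (p'_above : lies_above (val p') (val p)).
Context (binv : 'cV[adele Fh' [set oo']]_r' -> 'cV[adele Fh [set oo]]_r).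
Context (binvK : cancel binv b).
Local Notation E := (b_proj b (p := p) (p' := p') binv).

(** The scalar that is 1 at p' and 0 at the other places above [p] is integral. It carries b_p(x) to
    b_p(E x), which stability puts in the image of the lattice, and b_p is injective. *)
Lemma b_proj_stable (Lambda : set 'cV[Fh (val p)]_r) x :
  Aprime_submodule [set b_at b x | x in Lambda] -> Lambda x -> Lambda (E *m x).
Proof.
case=> _ _ stable Lx.
pose a (w : above (oo' := oo') p) : Fh' (val (sval w)) :=
  if pselect (sval w = p') then 1 else 0.
have a_int w : integer (a w).
  by rewrite /a; case: pselect => ? /=; [exact: val_1_ge0 | left].
have [y Ly yE] : [set b_at b x | x in Lambda] (fun w => a w *: b_at b x w).
  by apply: stable => //; exists x.
rewrite b_projE // (_ : b_sec _ _ = y) //.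
apply: (b_single_inj oo'_unique (b := b)) => w.
rewrite yE /b_at -!/(single_mx _) b_single_sec // /a.
case: w => w wp /=; case: pselect => [wE|wE].
  by subst w; rewrite scale1r /vec_at at_single_mx.
by rewrite scale0r /vec_at at_single_mx_neq.
Qed.

Lemma b_proj_neq0 : (0 < r')%N -> E != 0.
Proof.
move=> r'_gt0; apply/negP => /eqP E0.
have res0 (y : 'cV[Fh' (val p')]_r') : y = 0.
  have := b_projE oo'_unique p'_above binvK (b_sec (p := p) binv y).
  rewrite E0 mul0mx b_secK // => /esym/(congr1 (b_res b (p' := p'))).
  by rewrite b_secK // b_res0.
have /matrixP/(_ (Ordinal r'_gt0) 0) := res0 (const_mx 1).
by rewrite !mxE => /eqP; rewrite oner_eq0.
Qed.
End ProjectionLattice.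

(* [compact_cover] is stated for pointed spaces only. *)
HB.instance Definition _ (F : fieldType) (Fh : completions F) (S : set (place F)) r :=
  isPointed.Build (GL r (adele Fh S)) 1%g.

(** * Finiteness of the residue field from compactness *)

Section ResidueFinite.
Context {F : fieldType} {oo : place F} {Fh : completions F} {r : nat}.
Context {p : primes_off [set oo]}.
Local Notation Fv := (Fh (val p)).
Local Notation vv := (@cval _ _ _ Fv).
Local Notation A := (adele Fh [set oo]).

Lemma entry_nbhd_open (c : Fv) i j n :
  open [set h : GL r A | val_ge vv n (GL_at p h i j - c)].
Proof.
rewrite GL_openE => g /= gc; exists [set p], n; split=> // h hg /=.
have [_ _ /(_ erefl) hp _] := hg i j p.
have -> : GL_at p h i j - c = (h i j - g i j) p + (GL_at p g i j - c).
  by rewrite /= !mxE; rewrite /at_place /=; ring.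
by apply: val_geD => //; exact: cvalP.
Qed.

Lemma scalar_GL_subproof (a : Fv) : a != 0 -> a%:M *m a^-1%:M = 1%:M :> 'M_r.
Proof. by move=> a0; rewrite -scalar_mxM mulfV. Qed.

Lemma scalar_GL_subproof' (a : Fv) : a != 0 -> a^-1%:M *m a%:M = 1%:M :> 'M_r.
Proof. by move=> a0; rewrite -scalar_mxM mulVf. Qed.

Definition scalar_GL (a : Fv) (a0 : a != 0) : GL r Fv :=
  MkGL (scalar_GL_subproof a0) (scalar_GL_subproof' a0).

(** The scalar matrices [1 + pi x], [x] integral, placed at [p], lie in [K]. Cover [K] by the open
    sets on which the entry (i, i) at [p] is constant modulo [pi ^ 2]: a finite subcover leaves
    finitely many [x] modulo [pi]. *)
Lemma residue_field_finite (K : subgroup (GL r A)) (B : GL r Fv) : (0 < r)%N ->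
  compact (sgset K) ->
  (forall k : GL r Fv, cong1 (v := vv) (B^-1 * k * B)%g -> sgset K (GL_single k)) ->
  finite_set (@residue_field _ _ Fv).
Proof.
move=> r_gt0 Kc Kcong; have vP := cvalP Fv; have [pi v_pi] := uniformizer_ex Fv.
pose i := Ordinal r_gt0.
have unit1 x : val_ge vv 0 x -> 1 + pi * x != 0 /\ val_ge vv 0 (1 + pi * x)^-1.
  move=> xint; have px : val_ge vv 1 (pi * x).
    by apply: (val_geM vP (m := 1) (n := 0)) => //; exact: uniformizer_ge.
  have n1 : ~ val_ge vv 1 (1 + pi * x).
    move=> h; have := val_geB vP h px; rewrite addrK => /(val_geE (oner_neq0 _)).
    by rewrite (val1 vP).
  have n0 : 1 + pi * x != 0 by apply/eqP => e; apply: n1; left.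
  split=> //; right; rewrite valV // oppr_ge0 leNgt; apply/negP => h.
  by apply: n1; right; lia.
have cong_scalar x (xint : val_ge vv 0 x) :
    sgset K (GL_single (scalar_GL (proj1 (unit1 x xint)))).
  set a := 1 + pi * x; apply: Kcong.
  have -> : (B^-1 * scalar_GL (proj1 (unit1 x xint)) * B)%g =
      scalar_GL (proj1 (unit1 x xint)).
    apply: GL_inj; rewrite !GLmxM /= mul_mx_scalar -scalemxAl.
    by rewrite GLVmx scalemx1.
  have px : val_ge vv 1 (pi * x).
    by apply: (val_geM vP (m := 1) (n := 0)) => //; exact: uniformizer_ge.
  split=> k l; rewrite /= !mxE -mulrnBl.
    by case: (k == l); rewrite ?mulr0n ?mulr1n; [rewrite addrC addKr | left].
  case: (k == l); rewrite ?mulr0n ?mulr1n; last by left.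
  have -> : a^-1 - 1 = - (pi * x) * a^-1.
    by rewrite /a; field; exact: (proj1 (unit1 x xint)).
  apply: (val_geM vP (m := 1) (n := 0)); first exact: val_geN.
  exact: (proj2 (unit1 x xint)).
move: Kc; rewrite compact_cover.
case/(_ _ (sgset K) (fun k => [set h | val_ge vv 2 (GL_at p h i i - GL_at p k i i)])).
- by move=> k _; apply: entry_nbhd_open.
- by move=> k Kk; exists k => //=; rewrite subrr; left.
move=> D' _ Dcover.
apply: (sub_finite_set _ (finite_image (fun k : GL r A =>
  [set y | maxideal (y - pi^-1 * (GL_at p k i i - 1))]) (finite_fset D'))).
move=> _ [x xint <-].
have [k Dk] := Dcover _ (cong_scalar x xint).
rewrite -[[set _ | _] _]/(val_ge vv 2 (GL_at p _ i i - GL_at p k i i)) GL_at_single.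
have -> : GLmx (scalar_GL (proj1 (unit1 x xint))) i i = 1 + pi * x.
  by rewrite /= mxE eqxx mulr1n.
move=> hk; exists k => //; apply/residue_class_eq.
move: (GL_at p k i i) hk => c hk; have pi0 := uniformizer_neq0 vP v_pi.
have := val_geN vP (val_geM vP (uniformizerV_ge vP v_pi) hk).
by rewrite /maxideal /= (_ : pi^-1 * (c - 1) - x = - (pi^-1 * (1 + pi * x - c))) //; field.
Qed.

End ResidueFinite.

(** * Coset counting, Hecke correspondences and the assembly *)

Section GroupCosets.
Context {G : groupType}.
Implicit Types (H K : subgroup G) (g k : G).

Lemma conj_conjgE (y x k : G) :
  (y^-1 * (y * x * y^-1 * k * (y * x * y^-1)^-1) * y = x * (y^-1 * k * y) * x^-1)%g.
Proof. by rewrite !invgM invgK !mulgA mulVg mul1g mulgVK. Qed.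

Lemma capsgE H K : sgset (capsg H K) = sgset H `&` sgset K.
Proof. by rewrite /capsg; case: capsg_subproof. Qed.

Lemma conjsgP K g k : sgset (conjsg K g) k <-> sgset K (g * k * g^-1)%g.
Proof.
rewrite /conjsg; case: conjsg_subproof => /= _ _ _; split=> [[k' Kk' <-]|Kk].
  by rewrite !mulgA mulgV mul1g mulgK.
by exists (g * k * g^-1)%g; rewrite // !mulgA mulVg mul1g mulgVK.
Qed.

Lemma lcosets_in_card (T : finType) K H (rep : T -> G) :
  (forall t, sgset K (rep t)) ->
  (forall s t, sgset H ((rep s)^-1 * rep t)%g -> s = t) ->
  (forall k, sgset K k -> exists t, sgset H ((rep t)^-1 * k)%g) ->
  lcosets_in K H #= `I_#|T|.
Proof.
move=> rep_in rep_inj rep_surj.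
have coset_eq x y : sgset H (x^-1 * y)%g <->
    [set (x * h)%g | h in sgset H] = [set (y * h)%g | h in sgset H].
  split=> [Hxy|e].
    apply/seteqP; split=> _ [h Hh <-].
      exists (y^-1 * x * h)%g; last by rewrite !mulgA mulgV mul1g.
      by apply: sgM => //; rewrite -[(y^-1 * x)%g]invgK invgM invgK; apply: sgV.
    exists (x^-1 * y * h)%g; last by rewrite !mulgA mulgV mul1g.
    exact: sgM.
  have : [set (y * h)%g | h in sgset H] y by exists 1%g; [exact: sg1 | rewrite mulg1].
  by rewrite -e => -[h Hh <-]; rewrite mulKg.
have -> : lcosets_in K H =
    [set [set (rep t * h)%g | h in sgset H] | t in [set: T]].
  apply/seteqP; split=> [_ [k /rep_surj[t /coset_eq e] <-]|_ [t _ <-]].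
    by exists t.
  by exists (rep t).
apply: (card_eq_trans (inj_card_eq _)).
  by move=> s t _ _ /coset_eq; exact: rep_inj.
have -> : `I_#|T| = [set (enum_rank t : nat) | t in [set: T]].
  apply/seteqP; split=> [n /= n_lt|_ [t _ <-]] //=.
  by exists (enum_val (Ordinal n_lt)) => //; rewrite enum_valK.
rewrite card_eq_sym; apply: inj_card_eq => s t _ _.
by move/val_inj/enum_rank_inj.
Qed.

End GroupCosets.

Section Hecke.
Context {F : fieldType} {Fh : completions F} {oo : place F} {r : nat}.
Context {C : fieldType} {c : Fh oo -> C}.
Local Notation GA := (GL r (adele Fh [set oo])).
Implicit Types (K : subgroup GA) (g : GA).

(** [hecke_proj] uses a chosen representative; any other differs from it by some [k] in [K''], and
    [g k g^-1] lies in [K]. *)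
Lemma hecke_projE g (K'' K : subgroup GA) (omega : period r c) (h : GA) :
  sgset K'' `<=` sgset (conjsg K g) ->
  hecke_proj g K (dmv_class K'' (omega, h)) = dmv_class K (omega, (h * g^-1)%g).
Proof.
move=> sub; set z := dmv_class K'' _.
have : dmv_rel K'' (dmv_repr z) (omega, h).
  have /eqmodP // : dmv_class K'' (dmv_repr z) = z by exact: reprK.
move/asboolP => [T [l [k [l0 /sub/conjsgP Kk e1 e2]]]].
rewrite /hecke_proj; apply/eqmodP/asboolP.
exists T, l, (g * k * g^-1)%g; split=> // v.
by have := e2 v; rewrite /= /GL_at !GLmapM => ->; rewrite !mulgA GLmapV mulgVK.
Qed.

End Hecke.

Section SubvarietyHecke.
Context {F : fieldType} {F' : fieldExtType F} {oo : place F} {oo' : place F'}.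
Context {Fh : completions F} {Fh' : completions F'} {r r' : nat}.
Context {C : fieldType} (c : Fh oo -> C) (c' : Fh' oo' -> C).

Lemma subvariety_sub_hecke (b : @adelic_iso F F' oo oo' Fh Fh' r r')
    (K : subgroup (GL r (adele Fh [set oo])))
    (g : GL r (adele Fh [set oo])) (g' : GL r' (adele Fh' [set oo'])) :
  (forall x, b (g *m x) = g' *m b x) ->
  subvariety b c c' K `<=` hecke g (subvariety b c c' K).
Proof.
move=> bg z [z' [f [omega' [h' [omega [h [_ -> omegaE hE]]]]]]].
have sub1 : sgset (capsg K (conjsg K g)) `<=` sgset (conjsg K 1%g).
  by rewrite capsgE => k [Kk _]; apply/conjsgP; rewrite mul1g invg1 mulg1.
have subg : sgset (capsg K (conjsg K g)) `<=` sgset (conjsg K g).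
  by rewrite capsgE => k [].
exists (dmv_class (capsg K (conjsg K g)) (omega, h * g)%g) => /=; last first.
  by rewrite hecke_projE // mulgK.
rewrite hecke_projE // invg1 mulg1.
(* With [h = phi^-1 h' b], the relation [b g = g' b] turns [h g] into [phi^-1 h' g' b]. *)
exists (dmv_class (bconj b K) (omega', (h' * g')%g)), f, omega', (h' * g')%g, omega, (h * g)%g.
split=> // x v w wv.
by rewrite !GLmxM -!mulmxA hE // bg.
Qed.

End SubvarietyHecke.

Section IdempotentLattice.
Context {F : fieldType} {v : place F} {Fv : completion v} {r : nat}.
Local Notation vv := (@cval _ _ _ Fv).

(** In the basis [B], stability of the lattice says that [M = B^-1 E B] is integral, so
    [idempotent_split] applies to [M]. *)
Lemma idempotent_lattice_split (B : GL r Fv) (E : 'M[Fv]_r) :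
  E *m E = E -> E != 0 ->
  (forall a : 'cV_r, mx_ge vv 0 a ->
     exists2 a' : 'cV_r, mx_ge vv 0 a' & GLmx B *m a' = E *m (GLmx B *m a)) ->
  exists (u : 'cV[Fv]_r) (phi : 'rV[Fv]_r) (j : 'I_r),
    [/\ mx_ge vv 0 u, mx_ge vv 0 phi, phi *m u = 1%:M, phi 0 j = 1
      & E *m (GLmx B *m u) = GLmx B *m u /\
        phi *m GLmx B^-1%g *m E = phi *m GLmx B^-1%g].
Proof.
move=> EE E0 stable; set M := GLmx B^-1%g *m E *m GLmx B.
have BM : GLmx B *m M = E *m GLmx B by rewrite !mulmxA -GLmxM mulgV mul1mx.
have MB : M *m GLmx B^-1%g = GLmx B^-1%g *m E.
  by rewrite -!mulmxA -GLmxM mulgV mulmx1.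
have MM : M *m M = M by rewrite {1}/M -mulmxA BM !mulmxA -(mulmxA _ E E) EE.
have M0 : M != 0.
  apply: contraNneq E0 => M0; rewrite -[E]mulmx1 -(GLmx1 (R := Fv)) -(mulgV B).
  by rewrite GLmxM mulmxA -BM M0 mulmx0 mul0mx.
have M_int : mx_ge vv 0 M.
  move=> i j; have [|a aint e] := stable (delta_mx j 0).
    by apply: mx_ge_delta; exact: cvalP.
  have Mj : col j M = a by rewrite colE -!mulmxA -e mulmxA -GLmxM mulVg mul1mx.
  by have := aint i 0; rewrite -Mj mxE.
have [u [phi [j [u_int phi_int phi_u phi_j [Mu phiM]]]]] :=
  idempotent_split (cvalP Fv) MM M_int M0.
exists u, phi, j; split=> //; split; first by rewrite mulmxA -BM -mulmxA Mu.
by rewrite -mulmxA -MB mulmxA phiM.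
Qed.

End IdempotentLattice.

Lemma hecke_good_prime (F : fieldType) (F' : fieldExtType F)
  (oo : place F) (oo' : place F')
  (oo'_unique : forall w : place F', lies_above w oo -> w = oo')
  (Fh : completions F) (Fh' : completions F')
  (C : fieldType) (c : Fh oo -> C) (c' : Fh' oo' -> C)
  (r r' : nat) (r_gt0 : (0 < r)%N) (r'_gt0 : (0 < r')%N)
  (K : subgroup (GL r (adele Fh [set oo]))) (K_compact : compact (sgset K))
  (b : @adelic_iso F F' oo oo' Fh Fh' r r')
  (p : primes_off [set oo])
  (Lambda : set 'cV[Fh (val p)]_r)
  (Kp : set (GL r (Fh (val p))))
  (Kaway : set (GL r (adele Fh [set oo; val p])))
  (p_good : good_prime b p K Lambda Kp Kaway)
  (p' : primes_off [set oo']) (p'_above : lies_above (val p') (val p))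
  (p'_degree : local_degree_one Fh Fh' p p') :
  let X : set (dmv (c := c) K) := subvariety b c c' K in
  exists (g' : GL r' (adele Fh' [set oo'])) (g : GL r (adele Fh [set oo])),
    [/\ forall w, w <> p' -> GL_at w g' = 1%g,
        forall x, b (g *m x) = g' *m b x,
        X `<=` hecke g X,
        lcosets_in K (capsg K (conjsg K g)) #=
          `I_(residue_card (Fh (val p)) ^ (r - 1))
      & (1 < r)%N -> forall k1 k2, Kp k1 -> Kp k2 ->
          ~ PGL_bounded (cyclic_subgroup (toPGL (k1 * GL_at p g * k2)%g))].
Proof.
move=> X; have [Lfree KpE KE _ stable] := p_good.
have [binv bK binvK] := biso_bij b.
have [B LE] := free_lattice_GL Lfree.
have [pi v_pi] := uniformizer_ex (Fh (val p)).
pose E := b_proj b (p := p) (p' := p') binv.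
have [u [phi [j [u_int phi_int phi_u phi_j [Eu phiE]]]]] :
    exists (u : 'cV[Fh (val p)]_r) (phi : 'rV[Fh (val p)]_r) (j : 'I_r),
    [/\ mx_ge (@cval _ _ _ (Fh (val p))) 0 u,
        mx_ge (@cval _ _ _ (Fh (val p))) 0 phi, phi *m u = 1%:M, phi 0 j = 1
      & E *m (GLmx B *m u) = GLmx B *m u /\
        phi *m GLmx B^-1%g *m E = phi *m GLmx B^-1%g].
  apply: idempotent_lattice_split; first exact: b_proj_idem.
    exact: b_proj_neq0.
  move=> a aint; have : Lambda (GLmx B *m a) by rewrite LE; exists a.
  by move/(b_proj_stable oo'_unique p'_above binvK stable); rewrite LE.
pose g0 := homothety (cvalP (Fh (val p))) v_pi phi_u.
pose gp := (B * g0 * B^-1)%g.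
(* [gp - 1] is a multiple of the column [B u] times the row [phi B^-1], which E fixes from the left
   and from the right: these are the two conditions of [b_transfer_GL]. *)
have gp1 : GLmx gp - 1%:M = (pi - 1) *: (GLmx B *m u *m (phi *m GLmx B^-1%g)).
  have -> : GLmx gp - 1%:M = GLmx B *m (GLmx g0 - 1%:M) *m GLmx B^-1%g.
    by rewrite mulmxBr mulmx1 mulmxBl -(GLmxM B B^-1%g) mulgV !GLmxM.
  by rewrite /= [1%:M + _ - _]addrC addKr -scalemxAr -scalemxAl !mulmxA.
have [||g' [g'_off bg]] := b_transfer_GL oo'_unique p'_above p'_degree binvK (g := gp).
- by rewrite gp1 -scalemxAl -mulmxA phiE.
- by rewrite gp1 -scalemxAr mulmxA Eu.
have KpP k : Kp k <-> cong1 (v := @cval _ _ _ (Fh (val p))) (B^-1 * k * B)%g.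
  by rewrite KpE LE; exact: congruence_subgroupP.
(* The part away from [p] is borrowed from the decomposition of the identity of [K]. *)
have K_single k : Kp k -> sgset K (GL_single k).
  move=> Kk; apply/KE; rewrite GL_at_single; split=> //.
  have [_ [k1 Kk1 e]] := (KE 1%g).1 (sg1 K); exists k1 => // v hv hv'.
  rewrite -(e v hv hv') GL_at_single_neq; first by rewrite /GL_at GLmap1.
  move=> vp; have /negP := hv'; apply; rewrite inE /=; right.
  by rewrite -vp.
have K_conj k : sgset K k ->
    sgset K (GL_single gp * k * (GL_single gp)^-1)%g <-> Kp (gp * GL_at p k * gp^-1)%g.
  move=> Kk; have atE v : GL_at v (GL_single gp * k * (GL_single gp)^-1)%g =
      (GL_at v (GL_single gp) * GL_at v k * (GL_at v (GL_single gp))^-1)%g.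
    by rewrite /GL_at !GLmapM GLmapV.
  split=> [/KE[]|Kgk]; first by rewrite atE GL_at_single.
  apply/KE; rewrite atE GL_at_single; split=> //.
  have [_ [k1 Kk1 e]] := (KE k).1 Kk; exists k1 => // v hv hv'.
  rewrite -(e v hv hv') atE GL_at_single_neq ?invg1 ?mulg1 ?mul1g //.
  move=> vp; have /negP := hv'; apply; rewrite inE /=; right.
  by rewrite -vp.
have Kp_conj k : Kp (gp * k * gp^-1)%g <->
    cong1 (v := @cval _ _ _ (Fh (val p))) (g0 * (B^-1 * k * B) * g0^-1)%g.
  by rewrite -conj_conjgE; exact: KpP.
have rf : finite_set (@residue_field _ _ (Fh (val p))).
  by apply: (residue_field_finite (B := B) r_gt0 K_compact) => k /KpP; exact: K_single.
have [rho [rho_int rho_inj rho_surj]] := residue_reps rf.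
exists g', (GL_single gp); split=> //.
- exact: subvariety_sub_hecke.
(* One residue for each of the r - 1 coordinates other than [j]. *)
- pose T := {ffun {l : 'I_r | l != j} -> 'I_(residue_card (Fh (val p)))}.
  have -> : (residue_card (Fh (val p)) ^ (r - 1) = #|{: T}|)%N.
    by rewrite card_ffun card_ord card_sig cardC1 card_ord subn1.
  pose rep (t : T) := (B * coset_rep pi phi_j rho t * B^-1)%g.
  have conj_rep k : (B^-1 * (B * k * B^-1) * B = k)%g.
    by rewrite !mulgA mulVg mul1g mulgVK.
  have Krep t : sgset K (GL_single (rep t)).
    by apply/K_single/KpP; rewrite conj_rep; apply: coset_rep_cong1 => //; exact: cvalP.
  have atV k l : GL_at p (k^-1 * l)%g = ((GL_at p k)^-1 * GL_at p l)%g.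
    by rewrite /GL_at GLmapM GLmapV.
  apply: (lcosets_in_card (rep := fun t => GL_single (rep t))) => //.
  + move=> s t; rewrite capsgE => -[Kst /conjsgP/(K_conj _ Kst)/Kp_conj].
    rewrite atV !GL_at_single.
    have -> : (B^-1 * ((rep s)^-1 * rep t) * B =
        (coset_rep pi phi_j rho s)^-1 * coset_rep pi phi_j rho t)%g.
      rewrite /rep; move: (coset_rep _ _ _ s) (coset_rep _ _ _ t) => x y.
      by rewrite !invgM invgK !mulgA mulVg mul1g !mulgVK.
    exact: coset_rep_inj.
  + move=> k Kk; have /KE[/KpP kc _] := Kk.
    have [t ht] := coset_rep_surj (cvalP _) v_pi u_int phi_int phi_u phi_j rho_int rho_surj kc.
    exists t; have Kt : sgset K ((GL_single (rep t))^-1 * k)%g.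
      by apply: sgM => //; apply: sgV.
    rewrite capsgE; split=> //; apply/conjsgP/(K_conj _ Kt)/Kp_conj.
    rewrite atV GL_at_single.
    have -> : (B^-1 * ((rep t)^-1 * GL_at p k) * B =
        (coset_rep pi phi_j rho t)^-1 * (B^-1 * GL_at p k * B))%g.
      rewrite /rep; move: (coset_rep _ _ _ t) => x.
      by rewrite !invgM invgK !mulgA mulVg mul1g.
    exact: ht.
- move=> r1 k1 k2 /KpP kc1 /KpP kc2; rewrite GL_at_single.
  exact: cyclic_unbounded.
Qed.

Theorem theorem7p2p2
  (Fq : finFieldType) (F : fieldExtType {fraction {poly Fq}})
  (F_constants : full_constants F)
  (oo : place F) (Fh : completions F) (Coo : Cinfinity (Fh oo))
  (F' : fieldExtType F) (inclF' : {rmorphism F' -> Coo})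
  (inclF'_F : forall x : F, inclF' x%:A = Cinf_emb Coo (cemb (Fh oo) x))
  (oo' : place F') (oo'_above : lies_above oo' oo)
  (oo'_unique : forall w : place F', lies_above w oo -> w = oo')
  (Fh' : completions F')
  (r r' : nat) (r_gt0 : (0 < r)%N) (r_eq : r = (r' * \dim {: F'}%VS)%N)
  (K : subgroup (GL r (adele Fh [set oo])))
  (K_open : open (sgset K)) (K_compact : compact (sgset K))
  (b : @adelic_iso F F' oo oo' Fh Fh' r r')
  (p : primes_off [set oo])
  (Lambda : set 'cV[Fh (val p)]_r)
  (Kp : set (GL r (Fh (val p))))
  (Kaway : set (GL r (adele Fh [set oo; val p])))
  (p_good : good_prime b p K Lambda Kp Kaway)
  (p' : primes_off [set oo']) (p'_above : lies_above (val p') (val p))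
  (p'_degree : local_degree_one Fh Fh' p p') :
  let c : Fh oo -> Coo := Cinf_emb Coo in
  let c' : Fh' oo' -> Coo := cont_ext (@cval _ _ _ Coo) inclF' in
  let X : set (dmv (c := c) K) := subvariety b c c' K in
  exists (g' : GL r' (adele Fh' [set oo'])) (g : GL r (adele Fh [set oo])),
    [/\ forall w, w <> p' -> GL_at w g' = 1%g,
        forall x, b (g *m x) = g' *m b x,
        X `<=` hecke g X,
        lcosets_in K (capsg K (conjsg K g)) #=
          `I_(residue_card (Fh (val p)) ^ (r - 1))
      & (1 < r)%N -> forall k1 k2, Kp k1 -> Kp k2 ->
          ~ PGL_bounded (cyclic_subgroup (toPGL (k1 * GL_at p g * k2)%g))].
Proof.
move=> c c' X; have r'_gt0 : (0 < r')%N by move: r_gt0; rewrite r_eq muln_gt0 => /andP[].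
exact: (hecke_good_prime oo'_unique c c' r_gt0 r'_gt0 K_compact p_good p'_above p'_degree).
Qed.
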